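(* Let $n\ge5$, $d\ge3$, and let $f\in\operatorname{Sym}^d(P_n^* )=\mathbb C[x_1,\dots,x_n]_d$ be a nondegenerate form whose Jacobian $J(f)$ is $S_n$-invariant, where $P_n=\mathbb C^n$ is the natural permutation module of $S_n$. Write $s=x_1+\cdots+x_n$ and $\mathcal F=\{g\in\operatorname{Sym}^d(P_n^* ):J(g)=J(f)\}$. All isomorphisms below are of $S_n$-modules. (i) If the canonical decomposition of $f$ has a single block $P_n$ (so that $\mathbb C f$ is $S_n$-invariant), suppose that $\mathbb C f$ affords the character $\chi\in\{1,\operatorname{sgn}\}$. Then $$J(f)\cong\chi\otimes P_n,\qquad \mathcal F=\mathbb C^\times f.$$ (ii) If the canonical decomposition of $f$ has the two blocks $T$ and $H_n$, write $f=as^d+h$, where $a\in\mathbb C$ and $h$ is the inflation to $P_n$ of a degree-$d$ form on $H_n$ such that $\mathbb C h$ affords the character $\chi\in\{1,\operatorname{sgn}\}$. Then $$J(f)\cong\mathbf 1\oplus(\chi\otimes H_n),\qquad \mathcal F=\{bs^d+ch: b,c\in\mathbb C^\times\},$$ where $\mathbf 1$ denotes the trivial one-dimensional module. Moreover, $\mathcal F$ contains a relative invariant if and only if $\chi=1$. (iii) If the canonical decomposition of $f$ has $n$ blocks, write $f=\sum_{i=1}^n c_i\ell_i^d$ with $c_i\in\mathbb C^\times$, $\ell_i=x_i+\gamma s$, $\gamma\in\mathbb C$, $1+n\gamma\ne0$. Then $$J(f)\cong P_n,\qquad \mathcal F=\left\{\sum_{i=1}^n b_i\ell_i^d: b_i\in\mathbb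 C^\times\right\}.$$ In particular, $\sum_{i=1}^n\ell_i^d$ is $S_n$-invariant.
   Context: $S_n$ acts on $P_n=\mathbb C^n$ by permuting coordinates; $P_n=T\oplus H_n$ with $T=\mathbb C(1,\dots,1)$ and $H_n=\{x\in\mathbb C^n:x_1+\cdots+x_n=0\}$. The inflation to $P_n$ of a form on $H_n$ is its pullback along the projection $P_n=T\oplus H_n\to H_n$. The group acts on forms by $(\sigma\cdot h)(x)=h(\sigma^{-1}x)$; a line $\mathbb C h$ affords the character $\chi$ if $\sigma\cdot h=\chi(\sigma)h$ for all $\sigma$; a relative invariant is a nonzero form $h$ with $\mathbb C h$ $S_n$-invariant. For $v\in P_n$, $D_v$ is directional differentiation; $J(f)=\langle D_vf:v\in P_n\rangle\subseteq\operatorname{Sym}^{d-1}(P_n^* )$ is the Jacobian, $S_n$-invariant if $\sigma\cdot J(f)=J(f)$ for all $\sigma\in S_n$. The form $f$ is nondegenerate if $D_vf=0$ implies $v=0$. Let $\Theta_f$ be the polarization of $f$ (the unique symmetric $d$-linear form with $\Theta_f(v,\dots,v)=f(v)$). The center of $f$ is $$Z(f)=\{X\in\operatorname{End}(P_n):\Theta_f(Xv_1,v_2,v_3,\dots,v_d)=\Theta_f(v_1,Xv_2,v_3,\dots,v_d)\ \text{for all }v_i\in P_n\},$$ a finite-dimensional commutative $\mathbb C$-algebra when $f$ is nondegenerate and $d\ge3$ (Harrison). If $e_1,\dots,e_r$ are its primitive idempotents, the canonical decomposition of $f$ is $P_n=V_1\oplus\cdots\oplus V_r$ with canonical blocks $V_i=e_iP_n$,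 and $f=f_1+\cdots+f_r$ with $f_i$ the restriction of $f$ to $V_i$ regarded as a form on $P_n$ via $e_i$. It is known that for a nondegenerate $f$ with $S_n$-invariant Jacobian ($n\ge5$) the canonical decomposition is either the single block $P_n$, or the two blocks $T,H_n$, or $n$ one-dimensional blocks permuted transitively by $S_n$, and that $f$ then has the form used in (i), (ii), (iii) respectively. *)

(* Defs.v *)
From HB Require Import structures.
From mathcomp Require Export all_boot all_order all_algebra all_fingroup.
From mathcomp Require Export complex mpoly reals.

Set Implicit Arguments.
Unset Strict Implicit.
Unset Printing Implicit Defensive.

Import GRing.Theory.
Local Open Scope ring_scope.

(** * The permutation module P_n = 'cV_n and its submodules *)

Section PermutationModule.
Variables (K : fieldType) (n : nat).
Implicit Types x y : 'cV[K]_n.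

(* sigma sends the basis vector e_j to e_(sigma j). *)
Definition permc (s : 'S_n) (x : 'cV[K]_n) : 'cV[K]_n :=
  \col_i x ((s^-1)%g i) 0.

Definition Tn : {vspace 'cV[K]_n} := <[const_mx 1]>%VS.

Definition Hn : {vspace 'cV[K]_n} :=
  lker (linfun (mulmx (const_mx 1 : 'rV[K]_n) : 'cV[K]_n -> 'cV[K]_1)).

Lemma memTn x : reflect (exists c, x = const_mx c) (x \in Tn).
Proof.
apply: (iffP (vlineP _ _)) => -[c ->]; exists c.
  by apply/colP => i; rewrite !mxE mulr1.
by apply/colP => i; rewrite !mxE mulr1.
Qed.

Lemma memHn x : (x \in Hn) = (\sum_i x i 0 == 0).
Proof.
rewrite memv_ker lfunE /=; apply/eqP/eqP => [/matrixP/(_ 0 0)|sx0].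
  by rewrite !mxE => sx0; rewrite -[RHS]sx0; apply: eq_bigr => i _; rewrite mxE mul1r.
apply/matrixP => i j; rewrite !ord1 !mxE -[RHS]sx0.
by apply: eq_bigr => k _; rewrite mxE mul1r.
Qed.

(* The matrix of the projection of P_n onto H_n along T. *)
Definition projH : 'M[K]_n := 1%:M - const_mx n%:R^-1.

Lemma projHE x : projH *m x = x - const_mx (n%:R^-1 * \sum_i x i 0).
Proof.
rewrite mulmxBl mul1mx; congr (_ - _); apply/colP => i; rewrite !mxE mulr_sumr.
by apply: eq_bigr => j _; rewrite mxE.
Qed.

Lemma projH_along x : x - projH *m x \in Tn.
Proof. by apply/memTn; eexists; rewrite projHE opprB addrC subrK. Qed.

Lemma projH_in x : n%:R != 0 :> K -> projH *m x \in Hn.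
Proof.
move=> n0; rewrite memHn projHE; under eq_bigr do rewrite !mxE.
by rewrite sumrB sumr_const card_ord -[X in _ - X]mulr_natl mulVKf ?subrr.
Qed.

Lemma permcD s a x y : permc s (a *: x + y) = a *: permc s x + permc s y.
Proof. by apply/colP => i; rewrite !mxE. Qed.

Lemma permc1 x : permc 1 x = x.
Proof. by apply/colP => i; rewrite !mxE invg1 perm1. Qed.

Lemma permcM s t x : permc (s * t)%g x = permc t (permc s x).
Proof. by apply/colP => i; rewrite !mxE invMg permM. Qed.

Lemma permc_Hn s x : x \in Hn -> permc s x \in Hn.
Proof.
rewrite !memHn => /eqP sx0; apply/eqP; rewrite -[RHS]sx0 (reindex_inj (@perm_inj _ s)) /=.
by apply: eq_bigr => i _; rewrite mxE permK.
Qed.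

End PermutationModule.

(** * S_n-modules *)

(* A module is a subspace [carr] of an ambient vector space, with an action of
   S_n on it.  The product [s * t] of permutations in MathComp is "s first, then
   t", which is why [act_comp] has this form for a left action. *)
Record snModule (K : fieldType) (n : nat) := SnModule {
  amb : lmodType K;
  carr : amb -> Prop;
  act : 'S_n -> amb -> amb;
  carr0 : carr 0;
  carr_lin : forall a u v, carr u -> carr v -> carr (a *: u + v);
  carr_act : forall s u, carr u -> carr (act s u);
  act_lin : forall s a u v, carr u -> carr v ->
    act s (a *: u + v) = a *: act s u + act s v;
  act_id : forall u, carr u -> act 1%g u = u;
  act_comp : forall s t u, carr u -> act (s * t)%g u = act t (act s u)
}.

Definition isoSn (K : fieldType) (n : nat) (M N : snModule K n) : Prop :=
  exists phi : amb M -> amb N,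
    [/\ forall u, carr u -> carr (phi u),
        forall a u v, carr u -> carr v -> phi (a *: u + v) = a *: phi u + phi v,
        forall u v, carr u -> carr v -> phi u = phi v -> u = v,
        forall w, carr w -> exists2 u, carr u & phi u = w
      & forall s u, carr u -> phi (act s u) = act s (phi u)].

Inductive linChar := TrivChar | SgnChar.

Definition charval (K : fieldType) (n : nat) (chi : linChar) (s : 'S_n) : K :=
  match chi with
  | TrivChar => 1
  | SgnChar => (-1) ^+ s
  end.
Arguments charval K {n} chi s.

Lemma charval1 (K : fieldType) n chi : charval K chi (1%g : 'S_n) = 1.
Proof. by case: chi => //=; rewrite odd_perm1. Qed.

Lemma charvalM (K : fieldType) n chi (s t : 'S_n) :
  charval K chi (s * t)%g = charval K chi t * charval K chi s.
Proof. by case: chi; rewrite /= ?mulr1 // odd_permM signr_addb mulrC. Qed.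

Section Modules.
Variables (K : fieldType) (n : nat).

Program Definition permMod : snModule K n :=
  @SnModule K n 'cV[K]_n (fun _ => True) (@permc K n) _ _ _ _ _ _.
Next Obligation. exact: permcD. Qed.
Next Obligation. exact: permc1. Qed.
Next Obligation. exact: permcM. Qed.

Program Definition HMod : snModule K n :=
  @SnModule K n 'cV[K]_n (fun x => x \in Hn K n) (@permc K n) _ _ _ _ _ _.
Next Obligation. exact: mem0v. Qed.
Next Obligation. by rewrite memvD ?memvZ. Qed.
Next Obligation. exact: permc_Hn. Qed.
Next Obligation. exact: permcD. Qed.
Next Obligation. exact: permc1. Qed.
Next Obligation. exact: permcM. Qed.

Program Definition trivMod : snModule K n :=
  @SnModule K n K^o (fun _ => True) (fun _ c => c) _ _ _ _ _ _.

(* chi (x) M: tensoring with a one-dimensional module rescales the action. *)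
Program Definition twistMod (chi : linChar) (M : snModule K n) : snModule K n :=
  @SnModule K n (amb M) (@carr K n M)
    (fun s u => charval K chi s *: act s u) _ _ _ _ _ _.
Next Obligation. exact: carr0. Qed.
Next Obligation. exact: carr_lin. Qed.
Next Obligation.
by rewrite -[_ *: _]addr0; apply: carr_lin; [apply: carr_act | apply: carr0].
Qed.
Next Obligation. by rewrite act_lin // scalerDr !scalerA mulrC. Qed.
Next Obligation. by rewrite charval1 scale1r act_id. Qed.
Next Obligation.
have actZ c : act t (c *: act s u) = c *: act t (act s u).
  have a0 : act t (0 : amb M) = 0.
    have := @act_lin _ _ M t 1 0 0 (carr0 M) (carr0 M).
    by rewrite !scale1r addr0 => /(congr1 (+%R^~ (- act t 0))); rewrite subrr addrK.
  rewrite -[X in act t X]addr0 act_lin ?a0 ?addr0 //; first exact: carr_act.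
  exact: carr0.
by rewrite actZ scalerA act_comp // charvalM.
Qed.

Program Definition sumMod (M N : snModule K n) : snModule K n :=
  @SnModule K n (amb M * amb N)%type (fun u => carr u.1 /\ carr u.2)
    (fun s u => (act s u.1, act s u.2)) _ _ _ _ _ _.
Next Obligation. by split; apply: carr0. Qed.
Next Obligation. by split; apply: carr_lin. Qed.
Next Obligation. by split; apply: carr_act. Qed.
Next Obligation. by rewrite /= !act_lin. Qed.
Next Obligation. by rewrite /= !act_id. Qed.
Next Obligation. by rewrite /= !act_comp. Qed.

End Modules.

(** * Forms on P_n *)

(* A form of degree d on P_n is an element of {mpoly K[n]} that is d.-homog.
   The action (sigma . h)(x) = h(sigma^-1 x) is the library's [msym]. *)
Section Forms.
Variables (K : fieldType) (n : nat).
Implicit Types (f g h p q : {mpoly K[n]}) (v x : 'cV[K]_n).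

Definition formval f v : K := f.@[fun i => v i 0].

Lemma formval_msym s h x : formval (msym s h) x = formval h (permc (s^-1)%g x).
Proof.
rewrite /formval [h]mpolyE (rmorph_sum (msym s)) !(rmorph_sum (meval _)) /=.
apply: eq_bigr => m _.
rewrite msymZ !mevalZ msymX !mevalX; congr (_ * _).
rewrite (reindex_inj (@perm_inj _ s)) /=; apply: eq_bigr => i _.
by rewrite !mxE invgK mnmE permK.
Qed.

Definition dirder v f : {mpoly K[n]} := \sum_i v i 0 *: f^`M(i).

Definition jacobian f p : Prop :=
  exists (k : nat) (a : 'I_k -> K) (v : 'I_k -> 'cV[K]_n),
    p = \sum_j a j *: dirder (v j) f.

Definition same_jacobian f g : Prop := forall p, jacobian f p <-> jacobian g p.

Definition jacobian_invariant f : Prop :=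
  forall s p, (exists2 q, jacobian f q & p = msym s q) <-> jacobian f p.

Definition nondegenerate_form f : Prop := forall v, dirder v f = 0 -> v = 0.

(* The forms whose Jacobian is that of [f] (the set called F). *)
Definition jacobian_fiber (d : nat) f g : Prop :=
  g \is d.-homog /\ same_jacobian g f.

Definition affords (chi : linChar) h : Prop :=
  forall s, msym s h = charval K chi s *: h.

Definition relative_invariant h : Prop :=
  h != 0 /\ forall s, exists c : K, msym s h = c *: h.

Lemma jacobian_lin f a p q :
  jacobian f p -> jacobian f q -> jacobian f (a *: p + q).
Proof.
move=> [k [b [v ->]]] [l [c [w ->]]].
exists (k + l)%N, (fun j => match split j with inl i => a * b i | inr i => c i end),
  (fun j => match split j with inl i => v i | inr i => w i end).
rewrite big_split_ord /= scaler_sumr; congr (_ + _); apply: eq_bigr => i _.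
  by rewrite (unsplitK (inl i)) scalerA.
by rewrite (unsplitK (inr i)).
Qed.

Program Definition jacMod f (fJ : jacobian_invariant f) : snModule K n :=
  @SnModule K n {mpoly K[n]} (jacobian f) (@msym n K) _ _ _ _ _ _.
Next Obligation.
by exists 0%N, (fun _ => 0), (fun _ => 0); rewrite big_ord0.
Qed.
Next Obligation. exact: jacobian_lin. Qed.
Next Obligation. by apply/(fJ s); exists u. Qed.
Next Obligation. by rewrite msymD msymZ. Qed.
Next Obligation. exact: msym1m. Qed.
Next Obligation. exact: msymMm. Qed.

(* [pullback X q] is the form x |-> q (X x). *)
Definition pullback (X : 'M[K]_n) q : {mpoly K[n]} :=
  q \mPo [tuple \sum_j X i j *: 'X_j | i < n].

Lemma formval_pullback X q x : formval (pullback X q) x = formval q (X *m x).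
Proof.
rewrite /formval /pullback comp_mpoly_meval; apply: meval_eq => i.
rewrite tnth_mktuple mxE rmorph_sum /=; apply: eq_bigr => j _.
by rewrite mevalZ mevalXU.
Qed.

(* The degree-d forms on H_n are the restrictions to H_n of the degree-d forms
   [q] on P_n. *)
Definition inflated_from_Hn (d : nat) h : Prop :=
  exists2 q, q \is d.-homog & h = pullback (projH K n) q.

Definition sumx : {mpoly K[n]} := \sum_i 'X_i.

(** * Polarization, center and canonical decomposition *)

Definition update (d : nat) (v : {ffun 'I_d -> 'cV[K]_n}) (i : 'I_d) u :=
  [ffun j => if j == i then u else v j].

Definition is_polarization (d : nat) f
    (Theta : {ffun 'I_d -> 'cV[K]_n} -> K) : Prop :=
  [/\ forall (v : {ffun 'I_d -> 'cV[K]_n}) i a x y,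
        Theta (update v i (a *: x + y)) =
          a * Theta (update v i x) + Theta (update v i y),
      forall (v : {ffun 'I_d -> 'cV[K]_n}) (s : 'S_d),
        Theta [ffun i => v (s i)] = Theta v
    & forall x, Theta [ffun=> x] = formval f x].

(* The indices [i] and [j] are the first two arguments of Theta. *)
Definition form_center (d : nat) f (X : 'M[K]_n) : Prop :=
  exists2 Theta, @is_polarization d f Theta &
    forall (v : {ffun 'I_d -> 'cV[K]_n}) (i j : 'I_d),
      i = 0%N :> nat -> j = 1%N :> nat ->
      Theta (update v i (X *m v i)) = Theta (update v j (X *m v j)).

Definition center_idempotent d f (e : 'M[K]_n) : Prop :=
  form_center d f e /\ e *m e = e.

Definition primitive_idempotent d f (e : 'M[K]_n) : Prop :=
  [/\ center_idempotent d f e, e != 0 &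
      ~ exists e1 e2 : 'M[K]_n,
          [/\ center_idempotent d f e1, center_idempotent d f e2,
              e1 != 0, e2 != 0
            & [/\ e1 *m e2 = 0, e2 *m e1 = 0 & e = e1 + e2]]].

(* [Vs] lists the canonical blocks e P_n of [f], in some order, one for each
   primitive idempotent e of the center. *)
Definition canonical_decomposition d f (Vs : seq {vspace 'cV[K]_n}) : Prop :=
  exists es : seq 'M[K]_n,
    [/\ uniq es,
        forall e, e \in es <-> primitive_idempotent d f e
      & Vs = [seq limg (linfun (mulmx e : 'cV[K]_n -> 'cV[K]_n)) | e <- es]].

End Forms.

Arguments Tn {K n}.
Arguments Hn {K n}.
Arguments permMod {K n}.
Arguments HMod {K n}.
Arguments trivMod {K n}.
Arguments sumx {K n}.

(* Main.v *)
(* If J(g) = J(f), then D_v g = D_{Yv} f for a unique matrix Y; by symmetry of second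
   derivatives Y lies in the center Z(f), and conversely the units of Z(f) yield all
   such g.  So the fiber of f is read off from Z(f), which is a commutative algebra
   of matrices stable under conjugation by S_n.

   For one or two blocks, no idempotent of Z(f) splits H_n.  Take X in Z(f) and
   difference it along transpositions: the differences are matrices of rank at most
   4 with explicit shape, and comparing products of commuting conjugates either
   produces an idempotent splitting H_n, or puts all the matrices 1 u^T or all the
   matrices u 1^T, with u = e_i - e_j, into Z(f).  The last two possibilities
   contradict the nondegeneracy of f: they make D_1 f zero, respectively D_u f a
   multiple of s^(d-1) for all u.  Hence X is a combination of the identity and of
   the all-ones matrix.

   For n blocks, evaluating second derivatives on the basis dual to the l_i shows
   that Z(f) is diagonal in that basis. *)

From HB Require Import structures.
Require Import Defs.
From mathcomp Require Import boolp ring.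
Set Implicit Arguments.
Unset Strict Implicit.
Unset Printing Implicit Defensive.
Import GRing.Theory Num.Theory.
Local Open Scope ring_scope.

(** * Directional derivatives of forms *)

Section Derivatives.
Variables (K : numFieldType) (n : nat).
Implicit Types (f g h p q : {mpoly K[n]}) (v w x y : 'cV[K]_n) (s : 'S_n).

Lemma dirderDl v w p : dirder (v + w) p = dirder v p + dirder w p.
Proof. by rewrite -big_split; apply: eq_bigr => i _; rewrite mxE scalerDl. Qed.

Lemma dirderZl a v p : dirder (a *: v) p = a *: dirder v p.
Proof. by rewrite scaler_sumr; apply: eq_bigr => i _; rewrite mxE scalerA. Qed.

Lemma dirder0l p : dirder 0 p = 0.
Proof. by rewrite -(scale0r 0) dirderZl scale0r. Qed.

Lemma dirderNl v p : dirder (- v) p = - dirder v p.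
Proof. by rewrite -scaleN1r dirderZl scaleN1r. Qed.

Lemma dirderBl v w p : dirder (v - w) p = dirder v p - dirder w p.
Proof. by rewrite dirderDl dirderNl. Qed.

Lemma dirder_suml I (r : seq I) (P : pred I) (F : I -> 'cV[K]_n) p :
  dirder (\sum_(i <- r | P i) F i) p = \sum_(i <- r | P i) dirder (F i) p.
Proof.
by apply: (big_morph (fun v => dirder v p)) => [v w|];
  [exact: dirderDl | exact: dirder0l].
Qed.

Lemma dirder_is_linear v : linear (dirder v : {mpoly K[n]} -> {mpoly K[n]}).
Proof.
move=> a p q; rewrite /dirder scaler_sumr -big_split; apply: eq_bigr => i _.
by rewrite linearP scalerDr /= !scalerA mulrC.
Qed.

HB.instance Definition _ v :=
  GRing.isLinear.Build K {mpoly K[n]} {mpoly K[n]} _ (dirder v)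
    (dirder_is_linear v).

Lemma mderiv_dirder i v p : (dirder v p)^`M(i) = dirder v p^`M(i).
Proof.
rewrite /dirder linear_sum; apply: eq_bigr => j _.
by rewrite linearZ /= mderiv_comm.
Qed.

Lemma dirderC v w p : dirder v (dirder w p) = dirder w (dirder v p).
Proof.
rewrite {1}/dirder [RHS]linear_sum; apply: eq_bigr => i _.
by rewrite linearZ /= mderiv_dirder.
Qed.

Lemma dirderM v p q : dirder v (p * q) = dirder v p * q + p * dirder v q.
Proof.
rewrite /dirder mulr_suml mulr_sumr -big_split; apply: eq_bigr => i _ /=.
by rewrite mderivM scalerDr scalerAl scalerAr.
Qed.

Lemma dirderC0 v (c : K) : dirder v c%:MP = 0.
Proof. by rewrite /dirder big1 // => i _; rewrite mderivC scaler0. Qed.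

Lemma dirder_exp v p k :
  dirder v (p ^+ k.+1) = k.+1%:R *: (p ^+ k * dirder v p).
Proof.
elim: k => [|k IHk]; first by rewrite !expr1 expr0 mul1r scale1r.
rewrite exprS dirderM IHk -scalerAr mulrA -exprS [dirder v p * _]mulrC.
by rewrite -[k.+2%:R]natr1 scalerDl scale1r addrC.
Qed.

Lemma dirderXi v i : dirder v 'X_i = (v i 0)%:MP.
Proof.
rewrite /dirder (bigD1 i) //= big1 => [|j ji]; rewrite mderivX mnm1E.
  by rewrite eqxx -{1}[U_(i)%MM]add0m addmK mpolyX0 scale1r addr0 alg_mpolyC.
by rewrite eq_sym (negPf ji) scale0r scaler0.
Qed.

Definition vsum v : K := \sum_i v i 0.

Lemma dirder_sumx v : dirder v sumx = (vsum v)%:MP.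
Proof.
by rewrite /sumx /vsum linear_sum [RHS]raddf_sum; apply: eq_bigr => i _ /=; rewrite dirderXi.
Qed.

Lemma dirder_sumx_exp v k :
  dirder v (sumx ^+ k.+1) = (k.+1%:R * vsum v) *: sumx ^+ k.
Proof. by rewrite dirder_exp dirder_sumx -scalerA mulrC mul_mpolyC. Qed.

Lemma dhomog_mderiv d i f : f \is d.-homog -> f^`M(i) \is d.-1.-homog.
Proof.
move=> /dhomogP fd; rewrite [f]mpolyE linear_sum big_seq rpred_sum // => m /fd <-.
rewrite linearZ rpredZ //= mderivX.
have [->|mi0] := eqVneq (m i) 0%N; first by rewrite scale0r rpred0.
rewrite rpredZ // dhomogX.
have le1m : (U_(i) <= m)%MM by rewrite lep1mP.
by rewrite -{2}(submK le1m) mdegD mdeg1 addn1.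
Qed.

Lemma dhomog_dirder d v f : f \is d.-homog -> dirder v f \is d.-1.-homog.
Proof. by move=> fd; rewrite rpred_sum // => i _; rewrite rpredZ // dhomog_mderiv. Qed.

Lemma euler d f : f \is d.-homog -> \sum_i 'X_i * f^`M(i) = d%:R *: f.
Proof.
move=> /dhomogP fd.
have monomial m : \sum_i 'X_i * ('X_[m] : {mpoly K[n]})^`M(i) = (mdeg m)%:R *: 'X_[m].
  rewrite mdegE natr_sum scaler_suml; apply: eq_bigr => i _.
  rewrite mderivX -scalerAr -mpolyXD.
  (* Subtraction of exponents truncates when [m i] is 0, but the coefficient is then 0. *)
  have [->|mi0] := eqVneq (m i) 0%N; first by rewrite !scale0r.
  by rewrite addmC submK // lep1mP.
rewrite [f]mpolyE scaler_sumr.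
transitivity (\sum_(m <- msupp f) f@_m *: (\sum_i 'X_i * 'X_[m]^`M(i))).
  under eq_bigr => i _ do rewrite linear_sum mulr_sumr.
  rewrite exchange_big; apply: eq_bigr => m _; rewrite scaler_sumr.
  by apply: eq_bigr => i _; rewrite linearZ /= scalerAr.
by apply: eq_big_seq => m /fd <-; rewrite monomial !scalerA mulrC.
Qed.

Definition evec i : 'cV[K]_n := delta_mx i 0.

Lemma evecE i k : evec i k 0 = (k == i)%:R.
Proof. by rewrite mxE eqxx andbT. Qed.

Lemma vsum_is_linear : linear_for *%R (vsum).
Proof.
move=> a v w; rewrite /vsum mulr_sumr -big_split; apply: eq_bigr => i _.
by rewrite !mxE.
Qed.

HB.instance Definition _ :=
  GRing.isLinear.Build K 'cV[K]_n K *%R (vsum) vsum_is_linear.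

Lemma vsumZ a v : vsum (a *: v) = a * vsum v.
Proof. exact: linearZ. Qed.

Lemma vsumD v w : vsum (v + w) = vsum v + vsum w.
Proof. exact: linearD. Qed.

Lemma vsumB v w : vsum (v - w) = vsum v - vsum w.
Proof. exact: linearB. Qed.

Lemma vsum_evec i : vsum (evec i) = 1.
Proof.
rewrite /vsum (bigD1 i) //= big1 => [|k /negPf ki]; rewrite evecE ?ki // eqxx.
by rewrite addr0.
Qed.

Lemma dirder_evec i f : dirder (evec i) f = f^`M(i).
Proof.
rewrite /dirder (bigD1 i) //= big1 => [|j ji]; rewrite mxE ?eqxx ?scale1r ?addr0 //.
by rewrite (negPf ji) scale0r.
Qed.

(** Euler's identity writes (d+1) f through the partial derivatives, and d+1 is invertible. Degree 0
    is excluded because nonzero constants have zero derivatives. *)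
Lemma dirder_eq0 d f :
  f \is d.+1.-homog -> (forall v, dirder v f = 0) -> f = 0.
Proof.
move=> /euler eu D0; apply: (@scalerI _ _ d.+1%:R); first by rewrite pnatr_eq0.
by rewrite scaler0 -eu big1 // => i _; rewrite -dirder_evec D0 mulr0.
Qed.

Lemma formval_euler d f x :
  f \is d.-homog -> formval (dirder x f) x = d%:R * formval f x.
Proof.
move=> /euler/(congr1 (fun g => formval g x)); rewrite /formval mevalZ => <-.
rewrite /dirder !raddf_sum; apply: eq_bigr => i _ /=.
by rewrite mevalZ mevalM mevalXU.
Qed.

Lemma dhomog0_const f : f \is 0.-homog -> f = (f@_0)%:MP.
Proof.
move=> f0; apply/mpolyP => m; rewrite mcoeffC.
have [->|m0] := eqVneq m 0%MM; first by rewrite mulr1.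
by rewrite mulr0; apply: dhomog_nemf_coeff f0 _; rewrite mdeg_eq0.
Qed.

Lemma sumx_homog k : (sumx ^+ k : {mpoly K[n]}) \is k.-homog.
Proof.
rewrite -[k in k.-homog]mul1n; apply: dhomogMn; rewrite rpred_sum // => i _.
by rewrite dhomogX; apply/eqP/mdeg1.
Qed.

Lemma sumx_exp_neq0 k : (0 < n)%N -> (sumx ^+ k : {mpoly K[n]}) != 0.
Proof.
move=> n0; apply: expf_neq0; apply/eqP => /(congr1 (dirder (evec (Ordinal n0)))).
rewrite dirder_sumx linear0 => /eqP; rewrite mpolyC_eq0 /vsum (bigD1 (Ordinal n0)) //=.
rewrite big1 => [|i i0]; rewrite mxE ?eqxx ?addr0 ?oner_eq0 //.
by rewrite (negPf i0).
Qed.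

(** The common partial derivative again has equal partials, since mixed derivatives commute; by
    induction it is c s^(d-1), and Euler's identity integrates it. *)
Lemma dirder_const_sumx d f :
    f \is d.-homog -> (forall i j, f^`M(i) = f^`M(j)) ->
  exists c, f = c *: sumx ^+ d.
Proof.
elim: d f => [|d IHd] f fd eqD.
  by exists f@_0; rewrite [LHS]dhomog0_const // expr0 alg_mpolyC.
(* For n = 0 there is no index to differentiate along, and Euler's identity gives f = 0. *)
have := euler fd; case: (posnP n) => [n0|n0].
  rewrite big1 => [/esym/eqP|i _]; last by have := ltn_ord i; rewrite {2}n0.
  rewrite scaler_eq0 pnatr_eq0 /= => /eqP ->.
  by exists 0; rewrite scale0r.
pose o := Ordinal n0; have [||c Dc] := IHd f^`M(o).
- exact: (dhomog_mderiv o fd).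
- by move=> i j; rewrite ![f^`M(o)^`M(_)]mderiv_comm (eqD i j).
move=> eu; exists (d.+1%:R^-1 * c).
apply: (@scalerI _ _ d.+1%:R); first by rewrite pnatr_eq0.
rewrite scalerA mulrA divff ?pnatr_eq0 // mul1r -eu exprS /sumx mulr_suml scaler_sumr.
by apply: eq_bigr => i _; rewrite scalerAr (eqD i o) Dc.
Qed.

(** * Action of permutations on derivatives *)

Lemma msym_mderiv s i p : msym s p^`M(i) = (msym s p)^`M(s i).
Proof.
apply/mpolyP => m; rewrite mcoeff_sym !mcoeff_mderiv mcoeff_sym mnmE.
by congr (p@_ _ *+ _); apply/mnmP => j; rewrite !mnmDE !mnmE (inj_eq perm_inj).
Qed.

Lemma msym_dirder s v p : msym s (dirder v p) = dirder (permc s v) (msym s p).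
Proof.
rewrite /dirder linear_sum /= [RHS](reindex_inj (@perm_inj _ s)) /=.
by apply: eq_bigr => i _; rewrite linearZ /= msym_mderiv mxE permK.
Qed.

Lemma msym_sumx s : msym s sumx = sumx :> {mpoly K[n]}.
Proof.
rewrite /sumx linear_sum /= [RHS](reindex_inj (@perm_inj _ s)) /=.
apply: eq_bigr => i _; rewrite msymX; congr 'X_[_].
by apply/mnmP => j; rewrite mnmE !mnm1E (can2_eq (permK s) (permKV s)).
Qed.

Lemma msym_sumx_exp s k : msym s (sumx ^+ k) = sumx ^+ k :> {mpoly K[n]}.
Proof. by rewrite rmorphXn /= msym_sumx. Qed.

Lemma msym_homog d s f : f \is d.-homog -> msym s f \is d.-homog.
Proof.
move=> fd; apply/dhomogP => m; rewrite mcoeff_msupp mcoeff_sym => fm0.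
apply/eqP; apply: contraNT fm0 => dm; apply/eqP.
by apply: dhomog_nemf_coeff fd _; rewrite /= mdeg_mperm.
Qed.

End Derivatives.

(** * Jacobians and centers *)

Section Jacobians.
Variables (K : numFieldType) (n : nat).
Implicit Types (f g h p q : {mpoly K[n]}) (v w x y : 'cV[K]_n) (s : 'S_n).

Lemma jacobianP f p : jacobian f p <-> exists v, p = dirder v f.
Proof.
split=> [[k [a [v ->]]]|[v ->]].
  exists (\sum_j a j *: v j); rewrite dirder_suml.
  by apply: eq_bigr => j _; rewrite dirderZl.
by exists 1%N, (fun _ => 1), (fun _ => v); rewrite big_ord1 scale1r.
Qed.

Lemma nondegenerate_inj f v w :
  nondegenerate_form f -> dirder v f = dirder w f -> v = w.
Proof.
move=> f_nd e; apply/eqP; rewrite -subr_eq0; apply/eqP/f_nd.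
by rewrite dirderBl e subrr.
Qed.

Lemma cV_sum_evec v : v = \sum_i v i 0 *: evec K i.
Proof.
apply/colP => i; rewrite summxE (bigD1 i) //= big1 => [|j ji]; rewrite !mxE.
  by rewrite eqxx mulr1 addr0.
by rewrite eq_sym (negPf ji) mulr0.
Qed.

Lemma mulmx_cV_ext m (A B : 'M[K]_(m, n)) : (forall v, A *m v = B *m v) -> A = B.
Proof.
by move=> AB; apply/matrixP => i j; have /colP/(_ i) := AB (evec K j); rewrite -!colE !mxE.
Qed.

Lemma jacobian_sub_matrix f g :
    (forall p, jacobian g p -> jacobian f p) ->
  exists Y : 'M[K]_n, forall v, dirder v g = dirder (Y *m v) f.
Proof.
move=> gf; have colY i : exists y, dirder (evec K i) g = dirder y f.
  by apply/jacobianP/gf/jacobianP; exists (evec K i).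
have [y yE] := fin_all_exists colY.
exists (\matrix_(i, j) y j i 0) => v.
rewrite {1}[v]cV_sum_evec dirder_suml.
transitivity (dirder (\sum_i v i 0 *: y i) f).
  by rewrite dirder_suml; apply: eq_bigr => i _; rewrite !dirderZl yE.
congr dirder; apply/colP => i; rewrite summxE mxE; apply: eq_bigr => j _.
by rewrite !mxE mulrC.
Qed.

(** Surjectivity of Y rests on nondegeneracy: each D_w f is some D_v g = D_{Yv} f, whence Yv = w. *)
Lemma same_jacobian_matrix f g : nondegenerate_form f -> same_jacobian g f ->
  exists2 Y : 'M[K]_n, forall v, dirder v g = dirder (Y *m v) f &
    forall w, exists v, Y *m v = w.
Proof.
move=> f_nd gf; have [Y YE] := jacobian_sub_matrix (fun p => (gf p).1).
exists Y => // w; have /gf/jacobianP[v wv] : jacobian f (dirder w f).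
  by apply/jacobianP; exists w.
by exists v; apply: (nondegenerate_inj f_nd); rewrite -YE.
Qed.

Lemma same_jacobian_of_matrix f g (Y : 'M[K]_n) :
    (forall v, dirder v g = dirder (Y *m v) f) ->
    (forall w, exists v, Y *m v = w) ->
  same_jacobian g f.
Proof.
move=> YE Ys p; split=> /jacobianP[v ->]; apply/jacobianP.
  by exists (Y *m v).
by have [w <-] := Ys v; exists w.
Qed.

(* Z(f) in terms of derivatives: D_a D_b f is, up to a constant, the polarization
   of f with its first two arguments set to a and b. *)
Definition dcenter f (X : 'M[K]_n) : Prop :=
  forall a b, dirder (X *m a) (dirder b f) = dirder a (dirder (X *m b) f).

Lemma dcenter_scalar f c : dcenter f c%:M.
Proof. by move=> a b; rewrite !mul_scalar_mx !dirderZl linearZ. Qed.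

Lemma dcenterZ f c X : dcenter f X -> dcenter f (c *: X).
Proof. by move=> fX a b; rewrite -!scalemxAl !dirderZl linearZ /= fX. Qed.

Lemma dcenterD f X Y : dcenter f X -> dcenter f Y -> dcenter f (X + Y).
Proof. by move=> fX fY a b; rewrite !mulmxDl !dirderDl linearD /= fX fY. Qed.

Lemma dcenterB f X Y : dcenter f X -> dcenter f Y -> dcenter f (X - Y).
Proof. by move=> fX fY; rewrite -scaleN1r; apply/dcenterD/dcenterZ. Qed.

(** Both sides of the center condition are second derivatives D_a D_b g, which are symmetric. *)
Lemma dcenter_jacobian_matrix f g (Y : 'M[K]_n) :
  (forall v, dirder v g = dirder (Y *m v) f) -> dcenter f Y.
Proof. by move=> YE a b; rewrite dirderC -!YE dirderC. Qed.

(** * The center of a nondegenerate form as a commutative algebra *)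

Section Nondegenerate.
Variables (d : nat) (f : {mpoly K[n]}).
Hypotheses (d_ge3 : (3 <= d)%N) (f_form : f \is d.-homog).
Hypothesis f_nd : nondegenerate_form f.

(** Euler's identity applies to D_b D_v f and then to D_v f, whose degrees d-2 and d-1 are
    positive. *)
Lemma nondegenerate_dirder3 v :
  (forall b c, dirder c (dirder b (dirder v f)) = 0) -> v = 0.
Proof.
case: d d_ge3 f_form => [|[|[|k]]] // _ fk D0; apply: f_nd.
have fv : dirder v f \is k.+2.-homog by exact: (dhomog_dirder v fk).
apply: (dirder_eq0 fv) => b.
have fb : dirder b (dirder v f) \is k.+1.-homog by exact: (dhomog_dirder b fv).
by apply: (dirder_eq0 fb) => c; exact: D0.
Qed.

Lemma nondegenerate_dirder2 v : (forall b, dirder b (dirder v f) = 0) -> v = 0.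
Proof. by move=> D0; apply: nondegenerate_dirder3 => b c; rewrite D0 linear0. Qed.

(** Inside a third derivative each matrix can be moved to an argument of its own: applying XY or YX
    to a gives D_a D_{Xb} D_{Yc} f in both cases. *)
Lemma dcenter_comm X Y : dcenter f X -> dcenter f Y -> X *m Y = Y *m X.
Proof.
move=> fX fY; apply: mulmx_cV_ext => a; apply/eqP; rewrite -subr_eq0; apply/eqP.
apply: nondegenerate_dirder3 => b c; rewrite dirderBl !linearB /=.
apply/eqP; rewrite subr_eq0; apply/eqP; rewrite -!mulmxA.
transitivity (dirder (X *m b) (dirder a (dirder (Y *m c) f))).
  rewrite (dirderC b) fX (dirderC (Y *m a)) dirderC; congr dirder.
  by rewrite dirderC fY.
rewrite (dirderC c b) (dirderC c) fY (dirderC (X *m a)) (dirderC b (Y *m c)).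
by rewrite (dirderC b) fX (dirderC a (X *m b)) (dirderC (Y *m c)) (dirderC (Y *m c)).
Qed.

Lemma dcenterM X Y : dcenter f X -> dcenter f Y -> dcenter f (X *m Y).
Proof.
move=> fX fY a b.
by rewrite -{1}mulmxA fX fY mulmxA (dcenter_comm fX fY).
Qed.

(** With D_v g = D_{Yv} f and Y central, the condition for g becomes the one for f once X and Y are
    commuted. *)
Lemma dcenter_jacobian g X :
    (forall p, jacobian g p -> jacobian f p) -> dcenter f X -> dcenter g X.
Proof.
move=> /jacobian_sub_matrix[Y YE] fX a b.
have fY := dcenter_jacobian_matrix YE.
by rewrite !YE fX !mulmxA (dcenter_comm fX fY).
Qed.

End Nondegenerate.

(** The matrix of s X s^-1, as [mul_conj_perm_mx] shows. *)
Definition conj_perm_mx s (X : 'M[K]_n) : 'M[K]_n :=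
  \matrix_(i, j) X ((s^-1)%g i) ((s^-1)%g j).

Lemma mul_conj_perm_mx s X v : conj_perm_mx s X *m permc s v = permc s (X *m v).
Proof.
apply/colP => i; rewrite !mxE (reindex_inj (@perm_inj _ s)) /=.
by apply: eq_bigr => j _; rewrite !mxE permK.
Qed.

Lemma permcK s v : permc s (permc (s^-1)%g v) = v.
Proof. by rewrite -permcM mulVg permc1. Qed.

Lemma permc_is_linear s : linear (@permc K n s).
Proof. by move=> a x y; rewrite permcD. Qed.

HB.instance Definition _ s :=
  GRing.isLinear.Build K 'cV[K]_n 'cV[K]_n _ (@permc K n s) (permc_is_linear s).

Lemma permc_evec s i : permc s (evec K i) = evec K (s i).
Proof.
by apply/colP => j; rewrite !mxE (can2_eq (permKV s) (permK s)).
Qed.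

Lemma dcenter_msym s f X : dcenter f X -> dcenter (msym s f) (conj_perm_mx s X).
Proof.
move=> fX a b; rewrite -(permcK s a) -(permcK s b) !mul_conj_perm_mx.
by rewrite -!msym_dirder fX.
Qed.

Lemma jacobian_msym s f p : jacobian (msym s f) p <-> exists2 q, jacobian f q & p = msym s q.
Proof.
rewrite jacobianP; split=> [[v ->]|[q /jacobianP[v ->] ->]].
  exists (dirder (permc (s^-1)%g v) f); first by apply/jacobianP; eexists.
  by rewrite msym_dirder permcK.
by exists (permc s v); rewrite msym_dirder.
Qed.

(** Conjugation carries the center of f to that of [msym s f]; invariance of the Jacobian brings the
    result back to f through [dcenter_jacobian]. *)
Lemma dcenter_conj d s f X : (3 <= d)%N -> f \is d.-homog -> nondegenerate_form f ->
  jacobian_invariant f -> dcenter f X -> dcenter f (conj_perm_mx s X).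
Proof.
move=> d3 fd f_nd f_inv fX.
apply: (@dcenter_jacobian d (msym s f)) (dcenter_msym s fX) => //.
- exact: msym_homog.
- move=> v /(congr1 (msym (s^-1)%g)); rewrite msym_dirder -msymMm mulgV msym1m linear0.
  by move/f_nd => /(congr1 (permc s)); rewrite permcK linear0.
- by move=> p /(f_inv s) /jacobian_msym.
Qed.

End Jacobians.

(** * Polarization and primitive idempotents *)

Section Polarization.
Variables (K : numFieldType) (n : nat).
Implicit Types (f g h p q : {mpoly K[n]}) (v w x y : 'cV[K]_n) (l : seq 'cV[K]_n).

Definition iter_dirder l f := foldr (@dirder K n) f l.

Lemma iter_dirder_cat l1 l2 f :
  iter_dirder (l1 ++ l2) f = iter_dirder l1 (iter_dirder l2 f).
Proof. exact: foldr_cat. Qed.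

Lemma iter_dirder_rem x l f :
  x \in l -> iter_dirder l f = dirder x (iter_dirder (rem x l) f).
Proof.
elim: l => //= y l IHl; rewrite inE eq_sym; case: eqVneq => [->|yx] //= xl.
by rewrite IHl // dirderC.
Qed.

Lemma iter_dirder_perm l1 l2 f :
  perm_eq l1 l2 -> iter_dirder l1 f = iter_dirder l2 f.
Proof.
elim: l1 l2 => [|x l1 IHl] l2 l12.
  by rewrite (perm_nilP (_ : perm_eq l2 [::])) // perm_sym.
have xl2 : x \in l2 by rewrite -(perm_mem l12) mem_head.
rewrite (iter_dirder_rem _ xl2) /= (IHl (rem x l2)) //.
by rewrite -(perm_cons x) (permPl l12) perm_to_rem.
Qed.

(** The d-fold derivative of a form of degree d is a constant, which the coefficient at 0
    extracts. *)
Definition polar d f (v : {ffun 'I_d -> 'cV[K]_n}) : K :=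
  (d`!%:R)^-1 * (iter_dirder [seq v i | i <- enum 'I_d] f)@_0.

(** Iterated Euler identity at x: each derivative contributes the current degree, hence the falling
    factorial. Homogeneity is carried along for the induction. *)
Lemma iter_dirder_nseq d f x k : f \is d.-homog -> (k <= d)%N ->
  iter_dirder (nseq k x) f \is (d - k).-homog /\
  formval (iter_dirder (nseq k x) f) x = (d ^_ k)%:R * formval f x.
Proof.
move=> fd; elim: k => [|k IHk] kd; first by rewrite subn0 ffactn0 mul1r.
have [kh kE] := IHk (ltnW kd); split; first by rewrite subnS; apply: dhomog_dirder.
by rewrite /= (formval_euler _ kh) kE mulrA -natrM mulnC -ffactnSr.
Qed.

(** Derivatives commute, so the i-th argument can be moved to the front, where linearity in it is
    that of [dirder]. *)
Lemma polar_update d f (v : {ffun 'I_d -> 'cV[K]_n}) (i : 'I_d) u :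
  iter_dirder [seq update v i u j | j <- enum 'I_d] f =
  dirder u (iter_dirder [seq v j | j <- rem i (enum 'I_d)] f).
Proof.
rewrite (@iter_dirder_perm _ [seq update v i u j | j <- i :: rem i (enum 'I_d)]).
  rewrite /= ffunE eqxx; congr (dirder u (iter_dirder _ f)).
  apply/eq_in_map => j; rewrite mem_rem_uniq ?enum_uniq // inE => /andP[/negPf ji _].
  by rewrite ffunE ji.
by apply/perm_map/perm_to_rem; rewrite mem_enum.
Qed.

Lemma polarP d f : f \is d.-homog -> @is_polarization K n d f (@polar d f).
Proof.
move=> fd; split.
- move=> v i a x y; rewrite /polar !polar_update dirderDl dirderZl.
  by rewrite mcoeffD mcoeffZ mulrDr mulrCA.
- move=> v s; congr (_ * _@_0).
  rewrite (@iter_dirder_perm _ [seq v j | j <- [seq s i | i <- enum 'I_d]]).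
    apply: iter_dirder_perm; apply/perm_map/uniq_perm; rewrite ?enum_uniq //.
      by rewrite map_inj_uniq ?enum_uniq //; exact: perm_inj.
    move=> j; rewrite mem_enum; apply/mapP; exists ((s^-1)%g j); rewrite ?mem_enum //.
    by rewrite permKV.
  rewrite -(map_comp v s) (eq_map (_ : _ =1 v \o s)) ?perm_refl // => i.
  by rewrite ffunE.
- move=> x; have [h0 hE] := iter_dirder_nseq x fd (leqnn d).
  rewrite /polar (_ : map _ _ = nseq d x); last first.
    by rewrite -[in RHS](size_enum_ord d); elim: (enum 'I_d) => //= i l ->; rewrite ffunE.
  move: h0; rewrite subnn => /dhomog0_const h0; move: hE.
  rewrite h0 /formval mevalC mcoeffC eqxx mulr1 => ->.
  by rewrite ffactnn mulKf // pnatr_eq0 -lt0n fact_gt0.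
Qed.

(** The first two arguments are moved innermost, next to f, where membership in [dcenter] passes X
    from one to the other. *)
Lemma dcenter_form_center d f X : f \is d.-homog -> dcenter f X -> form_center d f X.
Proof.
move=> fd fX; exists (@polar d f); first exact: polarP.
move=> v i j i0 j1; rewrite /polar !polar_update; congr (_ * _@_0).
have ij : i != j by rewrite -val_eqE /= i0 j1.
have iE : i \in rem j (enum 'I_d) by rewrite mem_rem_uniq ?enum_uniq // inE ij mem_enum.
have jE : j \in rem i (enum 'I_d) by rewrite mem_rem_uniq ?enum_uniq // inE eq_sym ij mem_enum.
rewrite (iter_dirder_perm _ (perm_map v (perm_to_rem jE))).
rewrite (iter_dirder_perm _ (perm_map v (perm_to_rem iE))) /=.
have -> : rem j (rem i (enum 'I_d)) = rem i (rem j (enum 'I_d)).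
  move: (enum 'I_d) (enum_uniq 'I_d) => r ur.
  rewrite !rem_filter ?filter_uniq // -!filter_predI.
  by apply: eq_filter => k /=; rewrite andbC.
move: (map _ _) => l.
have swap (a b : 'cV_n) :
    dirder a (dirder b (iter_dirder l f)) = iter_dirder l (dirder a (dirder b f)).
  rewrite -[LHS]/(iter_dirder ([:: a; b] ++ l) f).
  rewrite (iter_dirder_perm _ (_ : perm_eq _ (l ++ [:: a; b]))).
    exact: iter_dirder_cat.
  by rewrite perm_catC.
by rewrite !swap fX [in RHS]dirderC.
Qed.

(** Induction on the rank: if q is not primitive it splits as e1 + e2, and the induction applies to
    e1. *)
Lemma primitive_idempotent_below d f (q : 'M[K]_n) :
    center_idempotent d f q -> q != 0 ->
  exists p : 'M[K]_n, [/\ primitive_idempotent d f p, p *m q = p & q *m p = p].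
Proof.
have [r] := ubnP (\rank q); elim: r q => // r IHr q; rewrite ltnS => qr cq q0.
have [prim|] := pselect (primitive_idempotent d f q).
  by exists q; case: cq => _ qq.
move=> nprim; have : exists e1 e2 : 'M[K]_n,
    [/\ center_idempotent d f e1, center_idempotent d f e2, e1 != 0, e2 != 0
      & [/\ e1 *m e2 = 0, e2 *m e1 = 0 & q = e1 + e2]].
  by apply: contrapT => no; apply: nprim; split.
move=> [e1 [e2 [c1 c2 e10 e20 [e12 e21 qE]]]].
have [[_ e1e1] [_ e2e2]] := (c1, c2).
have e1q : e1 *m q = e1 by rewrite qE mulmxDr e1e1 e12 addr0.
have qe1 : q *m e1 = e1 by rewrite qE mulmxDl e1e1 e21 addr0.
have [|p [pp pe1 e1p]] := IHr e1 _ c1 e10.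
  (* The rank drops strictly: q = D e1 would give q e1 = q, while q e1 = e1, so that e2 = 0. *)
  apply: leq_trans qr; apply: rank_ltmx; rewrite ltmxE -{1}e1q submxMl /=.
  apply/negP => /submxP[D qD]; move: e20; rewrite -(addKr e1 e2) -qE.
  by rewrite qD -{1}qe1 qD -mulmxA e1e1 addNr eqxx.
exists p; split=> //; first by rewrite -pe1 -mulmxA e1q.
by rewrite -e1p mulmxA qe1.
Qed.

End Polarization.

(** * Commuting families of matrices stable under S_n *)

Section StableMatrices.
Variables (K : numFieldType) (n : nat).
Implicit Types (v w x y : 'cV[K]_n) (s : 'S_n) (i j k l : 'I_n) (X Y : 'M[K]_n).

Definition uvec i j : 'cV[K]_n := evec K i - evec K j.
Definition onev : 'cV[K]_n := const_mx 1.
Definition outer x y : 'M[K]_n := x *m y^T.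

Lemma uvecE i j k : uvec i j k 0 = (k == i)%:R - (k == j)%:R.
Proof. by rewrite !mxE !eqxx !andbT. Qed.

Lemma outerE x y k l : outer x y k l = x k 0 * y l 0.
Proof. by rewrite mxE big_ord1 !mxE. Qed.

Lemma outer_mul x y v : outer x y *m v = (\sum_k y k 0 * v k 0) *: x.
Proof.
apply/colP => i; rewrite mxE [RHS]mxE mulr_suml; apply: eq_bigr => k _.
by rewrite outerE; ring.
Qed.

Lemma outer_evec_mul x i v : outer x (evec K i) *m v = v i 0 *: x.
Proof.
rewrite outer_mul (bigD1 i) //= big1 => [|k ki]; rewrite evecE ?eqxx ?mul1r ?addr0 //.
by rewrite (negPf ki) mul0r.
Qed.

Lemma outer_uvec_mul x i j v : outer x (uvec i j) *m v = (v i 0 - v j 0) *: x.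
Proof. by rewrite /outer /uvec linearB /= mulmxBr mulmxBl !outer_evec_mul scalerBl. Qed.

Lemma outer_onev_mul x v : outer x onev *m v = vsum v *: x.
Proof. by rewrite outer_mul; congr (_ *: _); apply: eq_bigr => k _; rewrite mxE mul1r. Qed.

Lemma permc_uvec s i j : permc s (uvec i j) = uvec (s i) (s j).
Proof. by rewrite linearB /= !permc_evec. Qed.

Lemma permc_onev s : permc s onev = onev.
Proof. by apply/colP => i; rewrite !mxE. Qed.

Lemma conj_perm_outer s x y :
  conj_perm_mx s (outer x y) = outer (permc s x) (permc s y).
Proof. by apply/matrixP => i j; rewrite mxE !outerE !mxE. Qed.

Lemma conj_perm_mxZ s a X : conj_perm_mx s (a *: X) = a *: conj_perm_mx s X.
Proof. by apply/matrixP => i j; rewrite !mxE. Qed.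

Lemma conj_perm_mxD s X Y :
  conj_perm_mx s (X + Y) = conj_perm_mx s X + conj_perm_mx s Y.
Proof. by apply/matrixP => i j; rewrite !mxE. Qed.

Lemma conj_perm_mxB s X Y :
  conj_perm_mx s (X - Y) = conj_perm_mx s X - conj_perm_mx s Y.
Proof. by apply/matrixP => i j; rewrite !mxE. Qed.

Lemma vsum_uvec i j : vsum (uvec i j) = 0.
Proof. by rewrite vsumB !vsum_evec subrr. Qed.

Lemma vsum_onev : vsum (onev) = n%:R.
Proof. by rewrite /vsum; under eq_bigr do rewrite mxE; rewrite sumr_const card_ord. Qed.

Lemma vsum_permc s v : vsum (permc s v) = vsum v.
Proof.
rewrite /vsum [RHS](reindex_inj (@perm_inj _ (s^-1)%g)) /=.
by apply: eq_bigr => i _; rewrite mxE.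
Qed.

Lemma uvec_Hn i j : uvec i j \in Hn.
Proof. by rewrite memHn; apply/eqP/vsum_uvec. Qed.

Lemma tperm_ifE i j k : tperm i j k = if k == i then j else if k == j then i else k.
Proof. by rewrite permE. Qed.

Lemma exists_fresh (r : seq 'I_n) : (size r < n)%N -> exists k, k \notin r.
Proof.
move=> rn; apply: contrapT => no; move: rn; rewrite ltnNge => /negP; apply.
rewrite -[n in (n <= _)%N]size_enum_ord; apply: uniq_leq_size; first exact: enum_uniq.
by move=> k _; apply/negPn/negP => kr; apply: no; exists k.
Qed.

(** Double transitivity: the second transposition sends the image of j to l and leaves k alone. *)
Lemma tperm2 i j k l : i != j -> k != l ->
  let s := (tperm i k * tperm (tperm i k j) l)%g in s i = k /\ s j = l.
Proof.
move=> ij kl; rewrite /= !permM tpermL; split; last by rewrite tpermL.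
have tk : tperm i k j != k.
  by apply: contra_neq ij => /(canRL (tpermK i k)); rewrite tpermR => ->.
by rewrite (tpermD tk) // eq_sym.
Qed.

Definition uniq4 i j k l := uniq [:: i; j; k; l].

(** The double difference only keeps entries with one index in {i, j} and the other in {k, l}; it is
    checked entry by entry. *)
Lemma second_difference X i j k l : uniq4 i j k l ->
  let Y := X - conj_perm_mx (tperm i j) X in
  Y - conj_perm_mx (tperm k l) Y =
    (X i k - X j k - X i l + X j l) *: outer (uvec i j) (uvec k l) +
    (X k i - X k j - X l i + X l j) *: outer (uvec k l) (uvec i j).
Proof.
rewrite /uniq4 /= !inE !negb_or !andbT => /andP[/and3P[ij ik il] /andP[/andP[jk jl] kl]].
apply/matrixP => r c.
have E := (negPf ij, negPf ik, negPf il, negPf jk, negPf jl, negPf kl).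
have sym (a b : 'I_n) : a != b -> (b == a) = false by rewrite eq_sym => /negPf.
have E' := (sym _ _ ij, sym _ _ ik, sym _ _ il, sym _ _ jk, sym _ _ jl, sym _ _ kl).
rewrite [RHS]mxE [X in _ = X + _]mxE [X in _ = _ + X]mxE !outerE !uvecE.
rewrite !mxE !tpermV.
have [->|ri] := eqVneq r i; [|have [->|rj] := eqVneq r j;
  [|have [->|rk] := eqVneq r k; [|have [->|rl] := eqVneq r l]]];
(have [->|ci] := eqVneq c i; [|have [->|cj] := eqVneq c j;
  [|have [->|ck] := eqVneq c k; [|have [->|cl] := eqVneq c l]]]);
do 4 rewrite ?tperm_ifE ?E ?E' ?eqxx ?(negPf ri) ?(negPf rj) ?(negPf rk) ?(negPf rl)
  ?(negPf ci) ?(negPf cj) ?(negPf ck) ?(negPf cl) /=; ring.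
Qed.

(** Only rows and columns i and j survive. On the right the (i, j) entry is alpha - beta, whence the
    last hypothesis, and the (i, i) entry fixes the first coefficient. *)
Lemma first_difference X i j (alpha beta : K) : i != j ->
    (forall k, k != i -> k != j -> X i k - X j k = alpha) ->
    (forall k, k != i -> k != j -> X k i - X k j = beta) ->
    X i j - X j i = alpha - beta ->
  X - conj_perm_mx (tperm i j) X =
    (X i i - X j j - alpha - beta) *:
      (outer (evec K i) (evec K i) - outer (evec K j) (evec K j)) +
    alpha *: outer (uvec i j) onev + beta *: outer onev (uvec i j).
Proof.
move=> ij Xr Xc Xij; apply/matrixP => r c.
have sym (a b : 'I_n) : a != b -> (b == a) = false by rewrite eq_sym => /negPf.
have E := (negPf ij, sym _ _ ij).
rewrite [RHS]mxE [X in _ = _ + X]mxE [X in _ = X + _]mxE.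
rewrite [X in _ = X + _ + _]mxE [X in _ = _ + X + _]mxE.
rewrite [X in _ = _ * X + _ + _]mxE [X in _ = _ * (_ + X) + _ + _]mxE !outerE !uvecE !evecE.
rewrite !mxE !tpermV !tperm_ifE.
have [->|ri] := eqVneq r i; [|have [->|rj] := eqVneq r j];
(have [->|ci] := eqVneq c i; [|have [->|cj] := eqVneq c j]);
rewrite ?E ?eqxx ?(negPf ri) ?(negPf rj) ?(negPf ci) ?(negPf cj) /= ?Xr ?Xc ?Xij //; try ring.
- by rewrite -[X j i - X i j]opprB Xij; ring.
- by rewrite -[X j c - X i c]opprB Xr //; ring.
- by rewrite -[X r j - X r i]opprB Xc //; ring.
Qed.

(** * Rigidity of commuting algebras stable under conjugation *)

Section Rigidity.
(** [Z] stands for the center of f. [Zidem] forbids idempotents splitting H_n; the last two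
    hypotheses will follow from nondegeneracy. *)
Variable Z : 'M[K]_n -> Prop.
Hypothesis n_ge4 : (4 <= n)%N.
Hypothesis ZB : forall X Y, Z X -> Z Y -> Z (X - Y).
Hypothesis ZZ : forall a X, Z X -> Z (a *: X).
Hypothesis ZM : forall X Y, Z X -> Z Y -> Z (X *m Y).
Hypothesis Zcomm : forall X Y, Z X -> Z Y -> X *m Y = Y *m X.
Hypothesis Zconj : forall s X, Z X -> Z (conj_perm_mx s X).
Hypothesis Zidem : forall q, Z q -> q *m q = q ->
  (forall h, h \in Hn -> q *m h = 0) \/ (forall h, h \in Hn -> q *m h = h).
Hypothesis not_Z_onev_uvec : ~ (forall i j, i != j -> Z (outer onev (uvec i j))).
Hypothesis not_Z_uvec_onev : ~ (forall i j, i != j -> Z (outer (uvec i j) onev)).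

Lemma swap_pairs i j k l : uniq4 i j k l ->
  exists s : 'S_n, [/\ s i = k, s j = l, s k = i & s l = j].
Proof.
rewrite /uniq4 /= !inE !negb_or !andbT => /andP[/and3P[ij ik il] /andP[/andP[jk jl] kl]].
exists (tperm i k * tperm j l)%g; rewrite !permM !tperm_ifE.
have sym (a b : 'I_n) : a != b -> (b == a) = false by rewrite eq_sym => /negPf.
have E := (negPf ij, negPf ik, negPf il, negPf jk, negPf jl, negPf kl).
have E' := (sym _ _ ij, sym _ _ ik, sym _ _ il, sym _ _ jk, sym _ _ jl, sym _ _ kl).
by split; do 3 rewrite ?eqxx ?E ?E' /=.
Qed.

(* Write Y for the second difference, a u w^T + b w u^T with u = e_i - e_j and
   w = e_k - e_l.  Commuting Y with its conjugate under (i k)(j l) gives a^2 = b^2;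
   if a <> 0 then Y^2 / (4 a b) is the projection onto <u, w>, excluded by Zidem. *)
Lemma second_difference0 X i j k l :
  Z X -> uniq4 i j k l -> X i k - X j k - X i l + X j l = 0.
Proof.
move=> ZX u4; have := second_difference X u4; cbv zeta.
set Y := LHS; set a := X i k - _ - _ + _; set b := X k i - _ - _ + _ => YE.
have ZY : Z Y by do !apply: ZB => //; do !apply: Zconj => //; apply: ZB => //; apply: Zconj.
have [s [si sj sk sl]] := swap_pairs u4.
set u := uvec i j in YE *; set w := uvec k l in YE *.
have Y'E : conj_perm_mx s Y = a *: outer w u + b *: outer u w.
  by rewrite YE conj_perm_mxD !conj_perm_mxZ !conj_perm_outer !permc_uvec si sj sk sl.
have act v : Y *m v = (a * (v k 0 - v l 0)) *: u + (b * (v i 0 - v j 0)) *: w.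
  by rewrite YE mulmxDl -!scalemxAl !outer_uvec_mul !scalerA.
have act' v : conj_perm_mx s Y *m v = (a * (v i 0 - v j 0)) *: w + (b * (v k 0 - v l 0)) *: u.
  by rewrite Y'E mulmxDl -!scalemxAl !outer_uvec_mul !scalerA.
move: u4; rewrite /uniq4 /= !inE !negb_or !andbT => /andP[/and3P[ij ik il] /andP[/andP[jk jl] kl]].
have sym (p q : 'I_n) : p != q -> (q == p) = false by rewrite eq_sym => /negPf.
have E := (negPf ij, negPf ik, negPf il, negPf jk, negPf jl, negPf kl, eqxx).
have E' := (sym _ _ ij, sym _ _ ik, sym _ _ il, sym _ _ jk, sym _ _ jl, sym _ _ kl).
have Yu : Y *m u = (2 * b) *: w.
  by rewrite act !uvecE !E !E' /= subrr mulr0 scale0r add0r; congr (_ *: _); ring.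
have Yw : Y *m w = (2 * a) *: u.
  by rewrite act !uvecE !E !E' /= subrr mulr0 scale0r addr0; congr (_ *: _); ring.
have Y'u : conj_perm_mx s Y *m u = (2 * a) *: w.
  by rewrite act' !uvecE !E !E' /= subrr mulr0 scale0r addr0; congr (_ *: _); ring.
have Y'w : conj_perm_mx s Y *m w = (2 * b) *: u.
  by rewrite act' !uvecE !E !E' /= subrr mulr0 scale0r add0r; congr (_ *: _); ring.
apply/eqP; apply: contraT => a0.
have ab : a ^+ 2 = b ^+ 2.
  have /(congr1 (fun M : 'M_n => (M *m u) i 0)) := Zcomm ZY (Zconj s ZY).
  rewrite -!mulmxA Y'u Yu -!scalemxAr Yw Y'w !scalerA [LHS]mxE [RHS]mxE uvecE !E /= => e.
  apply: (@mulfI _ 4%:R); first by rewrite pnatr_eq0.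
  by transitivity (2 * a * (2 * a) * (1 - 0)); [|rewrite e]; ring.
have b0 : b != 0.
  by apply: contraNneq a0 => b0; move/eqP: ab; rewrite b0 expr0n /= expf_eq0.
pose q := (4%:R * a * b)^-1 *: (Y *m Y).
have ab0 : 4%:R * a * b != 0 by rewrite !mulf_neq0 ?pnatr_eq0.
have actq v : q *m v = 2^-1 *: ((v i 0 - v j 0) *: u + (v k 0 - v l 0) *: w).
  rewrite -scalemxAl -mulmxA (act v) mulmxDr -!scalemxAr Yu Yw.
  rewrite scalerDr [RHS]scalerDr [LHS]addrC !scalerA.
  by congr (_ *: _ + _ *: _); field; rewrite ?a0 ?b0.
have qu : q *m u = u.
  rewrite actq !uvecE !E !E' /= subrr scale0r addr0 scalerA.
  by rewrite -[RHS]scale1r; congr (_ *: _); field.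
have qw : q *m w = w.
  rewrite actq !uvecE !E !E' /= subrr scale0r add0r scalerA.
  by rewrite -[RHS]scale1r; congr (_ *: _); field.
have qq : q *m q = q.
  by apply: mulmx_cV_ext => v; rewrite -mulmxA (actq v) -scalemxAr mulmxDr -!scalemxAr qu qw.
have Zq : Z q by apply/ZZ/ZM.
have [q0|q1] := Zidem Zq qq.
  have /colP/(_ i)/eqP := q0 u (uvec_Hn i j).
  by rewrite qu uvecE mxE !E /= subr0 oner_eq0.
(* Here q sends e_i - e_k to (u - w)/2, whose j-th coordinate is -1/2 instead of 0. *)
have /colP/(_ j) := q1 (uvec i k) (uvec_Hn i k).
rewrite actq mxE [X in _ * X]mxE [X in _ * (X + _)]mxE [X in _ * (_ + X)]mxE !uvecE !E !E' /=.
rewrite !(subr0, sub0r, mulr0, addr0, mul1r, mulrN1) => /eqP.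
by rewrite oppr_eq0 invr_eq0 pnatr_eq0.
Qed.

(** Vanishing second differences make X i k - X j k and X k i - X k j independent of k outside {i,
    j}. *)
Lemma first_difference_shape X i j : Z X -> i != j ->
  exists delta alpha beta, X - conj_perm_mx (tperm i j) X =
    delta *: (outer (evec K i) (evec K i) - outer (evec K j) (evec K j)) +
    alpha *: outer (uvec i j) onev + beta *: outer onev (uvec i j).
Proof.
move=> ZX ij.
have [k] : exists k, k \notin [:: i; j] by apply: exists_fresh; apply: ltnW.
rewrite !inE negb_or => /andP[ki kj].
have [l] : exists l, l \notin [:: i; j; k] by exact: exists_fresh.
rewrite !inE !negb_or => /and3P[li lj lk].
have [ik jk] : i != k /\ j != k by split; rewrite eq_sym.
have [il [jl kl]] : i != l /\ j != l /\ k != l by do ?split; rewrite eq_sym.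
pose alpha := X i k - X j k; pose beta := X k i - X k j.
exists (X i i - X j j - alpha - beta), alpha, beta; apply: first_difference => //.
- move=> m mi mj; have [->//|mk] := eqVneq m k; apply/eqP; rewrite -subr_eq0; apply/eqP.
  rewrite -[RHS](@second_difference0 X i j m k) //; first by rewrite /alpha; ring.
  by rewrite /uniq4 /= !inE !negb_or ij mk ik jk [i == m]eq_sym [j == m]eq_sym mi mj.
- move=> m mi mj; have [->//|mk] := eqVneq m k; apply/eqP; rewrite -subr_eq0; apply/eqP.
  rewrite -[RHS](@second_difference0 X m k i j) //; first by rewrite /beta; ring.
  by rewrite /uniq4 /= !inE !negb_or ij mk mi mj ki kj.
(* The combination R1 - R2 - R3 of three second differences is exactly X i j - X j i - alpha +
   beta. *)
- have R1 : X i j - X k j - X i l + X k l = 0.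
    by apply: second_difference0; rewrite // /uniq4 /= !inE !negb_or ik ij il kj kl jl.
  have R2 : X j i - X k i - X j l + X k l = 0.
    apply: second_difference0; rewrite // /uniq4 /= !inE !negb_or.
    by rewrite jk [j == i]eq_sym ij jl ki kl il.
  have R3 : X i k - X j k - X i l + X j l = 0.
    by apply: second_difference0; rewrite // /uniq4 /= !inE !negb_or ij ik il jk jl kl.
  apply/eqP; rewrite -subr_eq0 /alpha /beta; apply/eqP.
  transitivity ((X i j - X k j - X i l + X k l) - (X j i - X k i - X j l + X k l) -
    (X i k - X j k - X i l + X j l)); first by ring.
  by rewrite R1 R2 R3 !subr0.
Qed.
(* Commuting Y, of the shape above, with its conjugate under (i k)(j l) gives
   alpha delta + beta delta + n alpha beta = 0.  Then delta <> 0 would make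
   Y^2 / delta^2 a forbidden idempotent (in the case of n blocks, it is the sum of
   two of the primitive idempotents), so delta = 0 and alpha or beta vanishes. *)
Lemma first_difference0 X i j : Z X -> i != j -> conj_perm_mx (tperm i j) X = X.
Proof.
move=> ZX ij; have [delta [alpha [beta]]] := first_difference_shape ZX ij.
have [k] : exists k, k \notin [:: i; j] by apply: exists_fresh; apply: ltnW.
rewrite !inE negb_or => /andP[ki kj].
have [l] : exists l, l \notin [:: i; j; k] by exact: exists_fresh.
rewrite !inE !negb_or => /and3P[li lj lk].
set Y := LHS => YE.
have ZY : Z Y by apply: ZB => //; apply: Zconj.
have [ik jk] : i != k /\ j != k by split; rewrite eq_sym.
have [il [jl kl]] : i != l /\ j != l /\ k != l by do ?split; rewrite eq_sym.
have u4 : uniq4 i j k l by rewrite /uniq4 /= !inE !negb_or ij ik il jk jl kl.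
have [s [si sj sk sl]] := swap_pairs u4.
set u := uvec i j in YE; set w := uvec k l.
have Y'E : conj_perm_mx s Y =
    delta *: (outer (evec K k) (evec K k) - outer (evec K l) (evec K l)) +
    alpha *: outer w onev + beta *: outer onev w.
  rewrite YE !conj_perm_mxD !conj_perm_mxZ conj_perm_mxB !conj_perm_outer.
  by rewrite permc_uvec permc_onev !permc_evec si sj.
have act v : Y *m v = delta *: (v i 0 *: evec K i - v j 0 *: evec K j) +
    (alpha * vsum v) *: u + (beta * (v i 0 - v j 0)) *: onev.
  rewrite YE !mulmxDl -!scalemxAl mulmxBl !outer_evec_mul outer_onev_mul.
  by rewrite outer_uvec_mul !scalerA.
have act' v : conj_perm_mx s Y *m v =
    delta *: (v k 0 *: evec K k - v l 0 *: evec K l) +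
    (alpha * vsum v) *: w + (beta * (v k 0 - v l 0)) *: onev.
  rewrite Y'E !mulmxDl -!scalemxAl mulmxBl !outer_evec_mul outer_onev_mul.
  by rewrite outer_uvec_mul !scalerA.
have E := (negPf ij, negPf ik, negPf il, negPf jk, negPf jl, negPf kl, eqxx).
have E' := (negPf ki, negPf kj, negPf li, negPf lj, negPf lk).
have ji : (j == i) = false by rewrite eq_sym (negPf ij).
pose p := evec K i + evec K j.
have Yu : Y *m u = delta *: p + (2 * beta) *: onev.
  rewrite act vsum_uvec mulr0 scale0r addr0 !uvecE !E !ji /= subr0 sub0r scale1r scaleN1r opprK.
  by congr (_ + _ *: _); ring.
have Yw : Y *m w = 0.
  rewrite act vsum_uvec mulr0 scale0r addr0 !uvecE !E /= !subrr mulr0 !scale0r subrr.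
  by rewrite scaler0 addr0.
have Y'w : conj_perm_mx s Y *m w = delta *: (evec K k + evec K l) + (2 * beta) *: onev.
  rewrite act' vsum_uvec mulr0 scale0r addr0 !uvecE !E !E' /= subr0 sub0r scale1r scaleN1r opprK.
  by congr (_ + _ *: _); ring.
have Y1 : Y *m onev = (delta + n%:R * alpha) *: u.
  rewrite act vsum_onev ![onev _ _]mxE subrr mulr0 scale0r addr0 !scale1r -scalerDl.
  by rewrite mulrC.
have Yp : Y *m p = (delta + 2 * alpha) *: u.
  rewrite act vsumD !vsum_evec [p i 0]mxE [p j 0]mxE !evecE !E !ji /= addr0 add0r.
  rewrite subrr mulr0 scale0r addr0 !scale1r -scalerDl; congr (_ *: _); ring.
have Ykl : Y *m (evec K k + evec K l) = (2 * alpha) *: u.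
  rewrite act vsumD !vsum_evec !mxE !eqxx !andbT !E /= !addr0.
  by rewrite subrr mulr0 !scale0r subrr scaler0 add0r addr0; congr (_ *: _); ring.
have C : alpha * delta + beta * delta + n%:R * alpha * beta = 0.
  have /(congr1 (fun M : 'M_n => (M *m w) i 0)) := Zcomm ZY (Zconj s ZY).
  rewrite -!mulmxA Yw mulmx0 Y'w mulmxDr -!scalemxAr Ykl Y1 !scalerA -scalerDl.
  rewrite [LHS]mxE [RHS]mxE uvecE !E /= => e.
  apply: (@mulfI _ 2); first by rewrite pnatr_eq0.
  by rewrite mulr0 -e; ring.
have [d0|d0] := eqVneq delta 0; last first.
  have YYu : Y *m (Y *m u) = delta ^+ 2 *: u.
    rewrite Yu mulmxDr -!scalemxAr Yp Y1 !scalerA -scalerDl; congr (_ *: _).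
    by rewrite -[RHS]addr0 -[X in _ = _ + X](mulr0 2) -C; ring.
  pose q := (delta ^+ 2)^-1 *: (Y *m Y).
  have d2 : delta ^+ 2 != 0 by rewrite expf_neq0.
  have qE v : q *m v = (delta ^+ 2)^-1 *: (Y *m (Y *m v)) by rewrite -scalemxAl mulmxA.
  have qu : q *m u = u by rewrite qE YYu scalerA mulVf // scale1r.
  (* Y sends both p and the all-ones vector to multiples of u, so the values of Y^2 lie in the span
     of u and Yu, where q is the identity. *)
  have YYY v : exists c1 c2 : K, Y *m (Y *m v) = c1 *: u + c2 *: (Y *m u).
    (* Half sum and half difference rewrite v_i e_i - v_j e_j as h1 u + h2 p. *)
    pose h1 := (v i 0 + v j 0) / 2; pose h2 := (v i 0 - v j 0) / 2.
    pose h3 := beta * (v i 0 - v j 0).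
    have -> : Y *m v = (delta * h1 + alpha * vsum v) *: u + (delta * h2) *: p + h3 *: onev.
      by rewrite act; apply/colP => m; rewrite /u /p !mxE /h1 /h2 /h3; field.
    exists (delta * h2 * (delta + 2 * alpha) + h3 * (delta + n%:R * alpha)).
    exists (delta * h1 + alpha * vsum v).
    by rewrite 2!mulmxDr -!scalemxAr Yp Y1 !scalerA -addrA -scalerDl addrC.
  have qq : q *m q = q.
    apply: mulmx_cV_ext => v; rewrite -mulmxA [in RHS]qE [X in q *m X]qE -scalemxAr.
    congr (_ *: _); have [c1 [c2 ->]] := YYY v; rewrite mulmxDr -!scalemxAr qu.
    by rewrite {1}qE YYu -scalemxAr (scalerA (delta ^- 2)) mulVf // scale1r.
  have Zq : Z q by apply/ZZ/ZM.
  have [q0|q1] := Zidem Zq qq.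
    have /colP/(_ i)/eqP := q0 u (uvec_Hn i j).
    by rewrite qu uvecE mxE !E /= subr0 oner_eq0.
  have /colP/(_ k)/eqP := q1 w (uvec_Hn k l).
  by rewrite qE Yw mulmx0 scaler0 uvecE mxE !E /= subr0 eq_sym oner_eq0.
have n0 : n%:R != 0 :> K by rewrite pnatr_eq0 -lt0n (leq_trans _ n_ge4).
move: C; rewrite d0 !mulr0 !add0r -mulrA => /eqP; rewrite !mulf_eq0 (negPf n0) /=.
have [a0 _|a0 /= /eqP b0] := eqVneq alpha 0.
  have [b0|b0] := eqVneq beta 0.
    by move/eqP: YE; rewrite d0 a0 b0 !scale0r !addr0 subr_eq0 => /eqP.
  (* Double transitivity and stability under conjugation carry the single pair (i, j) to every
     pair. *)
  case: not_Z_onev_uvec => i' j' ij'.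
  have [t [ti tj]] : exists t : 'S_n, t i = i' /\ t j = j' by eexists; exact: tperm2.
  rewrite -ti -tj -permc_uvec -{1}(permc_onev t) -conj_perm_outer.
  apply: Zconj; rewrite -[outer _ _]scale1r -(mulVf b0) -scalerA; apply: ZZ.
  by move: ZY; rewrite YE d0 a0 !scale0r !add0r.
case: not_Z_uvec_onev => i' j' ij'.
have [t [ti tj]] : exists t : 'S_n, t i = i' /\ t j = j' by eexists; exact: tperm2.
rewrite -ti -tj -permc_uvec -(permc_onev t) -conj_perm_outer.
apply: Zconj; rewrite -[outer _ _]scale1r -(mulVf a0) -scalerA; apply: ZZ.
by move: ZY; rewrite YE d0 b0 !scale0r !add0r addr0.
Qed.

(** Invariance under all transpositions leaves one value on the diagonal and, by double
    transitivity, one off it. *)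
Lemma stable_scalar X : Z X -> exists a b : K, X = a%:M + const_mx b.
Proof.
move=> ZX.
have inv2 a b i j : X (tperm a b i) (tperm a b j) = X i j.
  have [<-|ab] := eqVneq a b; first by rewrite tperm1 !perm1.
  by rewrite -[in LHS](first_difference0 ZX ab) mxE tpermV !tpermK.
pose o := Ordinal (leq_trans (isT : 0 < 4) n_ge4)%N.
pose o' := Ordinal (leq_trans (isT : 1 < 4) n_ge4)%N.
exists (X o o - X o o'), (X o o'); apply/matrixP => i j; rewrite !mxE.
have [<-|ij] := eqVneq i j; first by rewrite mulr1n subrK -(inv2 o i o o) tpermL.
rewrite mulr0n add0r -[RHS](inv2 o i) -[RHS](inv2 (tperm o i o') j).
by have [] := @tperm2 o o' i j isT ij; rewrite !permM => -> ->.
Qed.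

End Rigidity.

End StableMatrices.

(** The natural maps run from the model modules to J(f), by v |-> D_v f, so they have to be
    inverted. Outside the carrier the chosen inverse is 0. *)
Lemma isoSn_sym (K : fieldType) n (M N : snModule K n) : isoSn M N -> isoSn N M.
Proof.
move=> [phi [phiC phiL phiI phiS phiA]].
have [|psi psiE] := @choice _ _ (fun w u => carr w -> carr u /\ phi u = w).
  move=> w; have [cw|nw] := pselect (@carr _ _ N w); last by exists 0.
  by have [u cu uw] := phiS w cw; exists u.
have psiC w : carr w -> carr (psi w) by case/psiE.
have psiK w : carr w -> phi (psi w) = w by case/psiE.
exists psi; split=> //.
- move=> a u v cu cv; have cuv := carr_lin a cu cv.
  by apply: phiI; rewrite ?psiK ?phiL ?psiK //; auto using carr_lin.
- by move=> u v cu cv e; rewrite -(psiK u) // -(psiK v) // e.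
- by move=> u cu; exists (phi u); [exact: phiC|apply: phiI; rewrite ?psiK; auto].
- move=> s w cw; have cs := carr_act s cw.
  by apply: phiI; rewrite ?psiK ?phiA ?psiK //; auto using carr_act.
Qed.

(** * A single block *)

Section JacobianShape.
Variables (K : numFieldType) (n d : nat).
Hypotheses (n_ge4 : (4 <= n)%N) (d_ge3 : (3 <= d)%N).
Implicit Types (f g h p q : {mpoly K[n]}) (v w x y : 'cV[K]_n) (s : 'S_n).
Implicit Types (i j k l : 'I_n) (X Y : 'M[K]_n).

Lemma n_neq0 : n%:R != 0 :> K.
Proof. by rewrite pnatr_eq0 -lt0n (leq_trans _ n_ge4). Qed.

Lemma vsum_Hn v : v \in Hn -> vsum v = 0.
Proof. by rewrite memHn => /eqP. Qed.

(** * The center when no idempotent splits H_n *)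

Section Fixed.
Variable f : {mpoly K[n]}.
Hypotheses (f_form : f \is d.-homog) (f_nd : nondegenerate_form f).
Hypothesis f_inv : jacobian_invariant f.

(** For l, m distinct from k, the matrix 1 (e_l - e_m)^T sends e_l to 1 and e_k to 0, so D_1 D_{e_k}
    f = 0 for every k, against nondegeneracy. *)
Lemma not_dcenter_onev_uvec :
  ~ (forall i j, i != j -> dcenter f (outer (onev K n) (uvec K i j))).
Proof.
move=> Z1u; suff one0 : onev K n = 0.
  pose o : 'I_n := Ordinal (leq_trans (isT : (0 < 4)%N) n_ge4).
  have /colP/(_ o)/eqP := one0.
  by rewrite !mxE oner_eq0.
apply: (nondegenerate_dirder2 d_ge3 f_form f_nd) => b.
rewrite [b]cV_sum_evec dirder_suml big1 // => k _; rewrite dirderZl.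
have [l] : exists l, l \notin [:: k] by apply: exists_fresh; apply: leq_trans n_ge4.
have [m] : exists m, m \notin [:: k; l] by apply: exists_fresh; apply: leq_trans n_ge4.
rewrite !inE negb_or => /andP[mk ml] lk.
have lm : l != m by rewrite eq_sym.
have := Z1u l m lm (evec K l) (evec K k).
rewrite !outer_uvec_mul !evecE eqxx (negPf ml) (negPf mk) (negPf lk).
rewrite subr0 subrr scale1r scale0r.
by rewrite dirder0l linear0 dirderC => ->; rewrite scaler0.
Qed.

(** The matrix u 1^T sends e_i to u and kills e_k - e_l, so all partials of D_u f agree and D_u f is
    a multiple of s^(d-1). Two independent u then contradict nondegeneracy. *)
Lemma not_dcenter_uvec_onev :
  ~ (forall i j, i != j -> dcenter f (outer (uvec K i j) (onev K n))).
Proof.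
move=> Zu1.
have Du i j : i != j -> exists c : K, dirder (uvec K i j) f = c *: sumx ^+ d.-1.
  move=> ij; apply: dirder_const_sumx; first exact: dhomog_dirder.
  move=> k l; apply/eqP; rewrite -subr_eq0 -!dirder_evec -dirderBl dirderC.
  have /(_ (evec K i) (uvec K k l)) := Zu1 i j ij.
  rewrite !outer_onev_mul vsum_uvec scale0r dirder0l linear0.
  rewrite /vsum (bigD1 i) //= big1 => [|m /negPf mi]; rewrite evecE ?mi // eqxx addr0 scale1r.
  by move=> ->.
pose o m (lt_m4 : (m < 4)%N) : 'I_n := Ordinal (leq_trans lt_m4 n_ge4).
pose i := o 0%N isT; pose j := o 1%N isT; pose k := o 2 isT.
have [c ijE] := Du i j isT; have [c' ikE] := Du i k isT.
have e : c' *: uvec K i j = c *: uvec K i k.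
  by apply: (nondegenerate_inj f_nd); rewrite !dirderZl ijE ikE !scalerA mulrC.
have c0 : c = 0.
  have /colP/(_ k) := e; rewrite mxE [RHS]mxE !uvecE /=.
  by rewrite !subrr mulr0 sub0r mulrN1 => /eqP; rewrite eq_sym oppr_eq0 => /eqP.
move: ijE; rewrite c0 scale0r => /f_nd/colP/(_ i)/eqP.
by rewrite uvecE mxE /= subr0 oner_eq0.
Qed.

(** The common consequence of having one or two blocks, in the form that [stable_scalar] takes. *)
Definition center_irreducible_on_Hn := forall q : 'M[K]_n, dcenter f q -> q *m q = q ->
  (forall v, v \in Hn -> q *m v = 0) \/ (forall v, v \in Hn -> q *m v = v).

Lemma dcenter_shape X : center_irreducible_on_Hn -> dcenter f X ->
  exists a b : K, X = a%:M + const_mx b.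
Proof.
move=> irr; apply: (@stable_scalar K n (dcenter f)) => //.
- exact: dcenterB.
- exact: dcenterZ.
- by move=> Y W; apply: (dcenterM d_ge3).
- by move=> Y W; apply: (dcenter_comm d_ge3).
- by move=> s Y; apply: (dcenter_conj s d_ge3).
- exact: not_dcenter_onev_uvec.
- exact: not_dcenter_uvec_onev.
Qed.

Lemma center_idempotent_dcenter (q : 'M[K]_n) :
  dcenter f q -> q *m q = q -> center_idempotent d f q.
Proof. by split=> //; apply: dcenter_form_center. Qed.

Lemma canonical_block Vs (p : 'M[K]_n) :
    canonical_decomposition d f Vs -> primitive_idempotent d f p ->
  exists2 V, V \in Vs & forall w, w \in V -> exists v, w = p *m v.
Proof.
move=> [es [_ esP ->]] /esP pes; exists (limg (linfun (mulmx p : 'cV[K]_n -> 'cV[K]_n))).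
  exact: map_f.
by move=> w /memv_imgP[v _ ->]; exists v; rewrite lfunE.
Qed.

(** A primitive p below a nonzero q has the whole space as image, so qp = p forces q = 1. *)
Lemma single_block_idempotent (q : 'M[K]_n) : canonical_decomposition d f [:: fullv] ->
  dcenter f q -> q *m q = q -> q = 0 \/ q = 1%:M.
Proof.
move=> dec qZ qq; have [->|q0] := eqVneq q 0; [by left | right].
have [p [pp _ qp]] := primitive_idempotent_below (center_idempotent_dcenter qZ qq) q0.
apply: mulmx_cV_ext => v; rewrite mul1mx.
have [V] := canonical_block dec pp; rewrite inE => /eqP -> /(_ v (memvf v))[w ->].
by rewrite mulmxA qp.
Qed.

Lemma single_block_irreducible :
  canonical_decomposition d f [:: fullv] -> center_irreducible_on_Hn.
Proof.
move=> dec q qZ qq; have [->|->] := single_block_idempotent dec qZ qq.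
  by left=> h _; rewrite mul0mx.
by right=> h _; rewrite mul1mx.
Qed.

Lemma dcenter_const c : dcenter f (outer (onev K n) (onev K n)) -> dcenter f (const_mx c).
Proof.
have -> : const_mx c = c *: outer (onev K n) (onev K n).
  by apply/matrixP => i j; rewrite [RHS]mxE outerE !mxE !mulr1.
exact: dcenterZ.
Qed.

(** Let P be the projection onto H_n, central by the first hypothesis. If qP is nonzero, a primitive
    idempotent below it has its image in H_n, so its block is H_n, and q fixes H_n. *)
Lemma two_blocks_irreducible : dcenter f (outer (onev K n) (onev K n)) ->
  canonical_decomposition d f [:: Tn; Hn] -> center_irreducible_on_Hn.
Proof.
move=> Z11 dec q qZ qq.
have PZ : dcenter f (projH K n).
  by apply: dcenterB; [exact: dcenter_scalar | exact: dcenter_const].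
have PH v : v \in Hn -> projH K n *m v = v.
  by move=> /vsum_Hn v0; rewrite projHE [\sum_i _]v0 mulr0; apply/colP => i; rewrite !mxE subr0.
have PP : projH K n *m projH K n = projH K n.
  by apply: mulmx_cV_ext => v; rewrite -mulmxA PH // projH_in ?n_neq0.
have qP := dcenter_comm d_ge3 f_form f_nd qZ PZ.
have rr : (q *m projH K n) *m (q *m projH K n) = q *m projH K n.
  by rewrite {2}qP mulmxA -(mulmxA q) PP -mulmxA -qP mulmxA qq.
have rZ : dcenter f (q *m projH K n) by exact: (dcenterM d_ge3).
have [r0|r0] := eqVneq (q *m projH K n) 0.
  by left=> h hH; rewrite -[h]PH // mulmxA r0 mul0mx.
have [p [pp _ rp]] := primitive_idempotent_below (center_idempotent_dcenter rZ rr) r0.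
have [V] := canonical_block dec pp; rewrite !inE => /orP[]/eqP-> pV.
  (* If the block were T, the all-ones vector would lie in the image of P and have coordinate sum
     0. *)
  have [|v] := pV (onev K n); first by apply/memTn; exists 1.
  rewrite -rp qP -!mulmxA => /(congr1 (@vsum K n)); rewrite vsum_onev vsum_Hn => [/eqP|].
    by rewrite (negPf n_neq0).
  by apply: projH_in; exact: n_neq0.
right=> h hH; rewrite -{1}(PH h) // mulmxA.
by have [v ->] := pV h hH; rewrite mulmxA rp.
Qed.

End Fixed.

Lemma form_eq_dirder f g : f \is d.-homog -> g \is d.-homog ->
  (forall v, dirder v f = dirder v g) -> f = g.
Proof.
case: d d_ge3 => // k _ fd gd fg; apply/eqP; rewrite -subr_eq0; apply/eqP.
by apply: (@dirder_eq0 K n k); [exact: rpredB | move=> v; rewrite linearB /= fg subrr].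
Qed.

(** The map v |-> D_v f is equivariant up to the character, as s.(D_v f) = D_{sv}(s.f). *)
Lemma jacobian_permMod_iso f (f_inv : jacobian_invariant f) chi :
  nondegenerate_form f -> affords chi f -> isoSn (jacMod f_inv) (twistMod chi permMod).
Proof.
move=> f_nd f_chi; apply: isoSn_sym; exists (fun v => dirder v f); split => /=.
- by move=> v _; apply/jacobianP; exists v.
- by move=> a u v _ _; rewrite dirderDl dirderZl.
- by move=> u v _ _; exact: nondegenerate_inj.
- by move=> w /jacobianP[v ->]; exists v.
- by move=> s u _; rewrite msym_dirder f_chi linearZ /= dirderZl.
Qed.

Lemma same_jacobianZ f c : c != 0 -> same_jacobian (c *: f) f.
Proof.
move=> c0; apply: (@same_jacobian_of_matrix K n f (c *: f) c%:M) => [v|w].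
  by rewrite linearZ mul_scalar_mx dirderZl.
by exists (c^-1 *: w); rewrite mul_scalar_mx scalerA divff ?scale1r.
Qed.

Lemma uvec_neq0 i j : i != j -> uvec K i j != 0.
Proof.
move=> ij; apply/eqP => /colP/(_ i)/eqP.
by rewrite uvecE mxE eqxx (negPf ij) subr0 oner_eq0.
Qed.

Lemma mul_const_mx b v : const_mx b *m v = (b * vsum v) *: onev K n.
Proof.
apply/colP => i; rewrite !mxE mulr1 mulr_sumr.
by apply: eq_bigr => j _; rewrite mxE.
Qed.

Lemma mul_scalar_const_mx (a b : K) v :
  (a%:M + const_mx b) *m v = a *: v + (b * vsum v) *: onev K n.
Proof. by rewrite mulmxDl mul_scalar_mx mul_const_mx. Qed.

(* The two scalars are the eigenvalues of a + b J on H_n and on T, J being the all-ones matrix. *)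
Lemma scalar_const_mx_surj (a b : K) :
    (forall w, exists v, (a%:M + const_mx b) *m v = w) ->
  a != 0 /\ a + n%:R * b != 0.
Proof.
move=> surj; split; apply/eqP => e.
  pose o : 'I_n := Ordinal (leq_trans (isT : (0 < 4)%N) n_ge4).
  pose o' : 'I_n := Ordinal (leq_trans (isT : (1 < 4)%N) n_ge4).
  have [v] := surj (uvec K o o').
  rewrite mul_scalar_const_mx e scale0r add0r => bv.
  have := vsum_uvec K o o'; rewrite -bv linearZ /= vsum_onev => /eqP.
  rewrite mulf_eq0 (negPf n_neq0) orbF => /eqP bv0.
  by move/eqP: bv; rewrite bv0 scale0r eq_sym (negPf (@uvec_neq0 o o' isT)).
have [v /(congr1 (@vsum K n))] := surj (onev K n).
rewrite mul_scalar_const_mx linearD /= !linearZ /= vsum_onev => /eqP.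
rewrite (_ : _ + _ = (a + n%:R * b) * vsum v); last by ring.
by rewrite e mul0r eq_sym (negPf n_neq0).
Qed.

(** The matrix Y with D_v g = D_{Yv} f is central, hence of the form a + bJ with J the all-ones
    matrix; it remains to show b = 0. *)
Lemma single_block_fiber f g : f \is d.-homog -> nondegenerate_form f ->
    jacobian_invariant f -> canonical_decomposition d f [:: fullv] ->
  jacobian_fiber d f g <-> exists2 c : K, c != 0 & g = c *: f.
Proof.
move=> fd f_nd f_inv dec; split=> [[gd gf]|[c c0 ->]]; last first.
  by split; [exact: rpredZ | exact: same_jacobianZ].
have [Y YE Ysurj] := same_jacobian_matrix f_nd gf.
have irr := single_block_irreducible fd dec.
have fY := dcenter_jacobian_matrix YE.
have [a [b Yab]] := dcenter_shape fd f_nd f_inv irr fY.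
have b0 : b = 0.
  (* Otherwise J/n would be a central idempotent other than 0 and 1. *)
  apply/eqP; apply: contraT => b0; pose q : 'M[K]_n := const_mx n%:R^-1.
  have fb : dcenter f (const_mx b).
    by rewrite -[const_mx b](addKr a%:M) -Yab addrC; apply: dcenterB => //; apply: dcenter_scalar.
  have fq : dcenter f q.
    have -> : q = (n%:R^-1 / b) *: const_mx b.
      by apply/matrixP => i j; rewrite !mxE divfK.
    exact: dcenterZ.
  have qq : q *m q = q.
    apply: mulmx_cV_ext => v; rewrite -mulmxA !mul_const_mx linearZ /= vsum_onev.
    by congr (_ *: _); field; exact: n_neq0.
  pose o : 'I_n := Ordinal (leq_trans (isT : (0 < 4)%N) n_ge4).
  pose o' : 'I_n := Ordinal (leq_trans (isT : (1 < 4)%N) n_ge4).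
  have [q0|q1] := single_block_idempotent fd dec fq qq.
    have /matrixP/(_ o o)/eqP := q0.
    by rewrite !mxE invr_eq0 (negPf n_neq0).
  have /matrixP/(_ o o')/eqP := q1.
  by rewrite !mxE invr_eq0 (negPf n_neq0).
move: Ysurj; rewrite Yab => /scalar_const_mx_surj[a0 _]; exists a => //.
apply: form_eq_dirder => // [|v]; first exact: rpredZ.
by rewrite YE Yab mul_scalar_const_mx b0 mul0r scale0r addr0 dirderZl linearZ.
Qed.

End JacobianShape.

(** * Derivatives of a form composed with a linear map *)

Section Pullback.
Variables (K : numFieldType) (n : nat) (X : 'M[K]_n).
Implicit Types (p q : {mpoly K[n]}) (v : 'cV[K]_n).

Lemma pullback_is_linear : linear (pullback X : {mpoly K[n]} -> {mpoly K[n]}).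
Proof. by move=> a p q; rewrite /pullback raddfD /= comp_mpolyZ. Qed.

HB.instance Definition _ :=
  GRing.isLinear.Build K {mpoly K[n]} {mpoly K[n]} _ (pullback X) pullback_is_linear.

(** The chain rule, checked on variables, extended to monomials by the product rule and then by
    linearity. *)
Lemma dirder_pullback v q : dirder v (pullback X q) = pullback X (dirder (X *m v) q).
Proof.
pose P q := dirder v (pullback X q) = pullback X (dirder (X *m v) q).
have PM p1 p2 : P p1 -> P p2 -> P (p1 * p2).
  move=> e1 e2; rewrite /P dirderM /pullback !rmorphM /= dirderM rmorphD !rmorphM /=.
  by rewrite -/(pullback X p1) -/(pullback X p2) e1 e2.
have P1 : P 1 by rewrite /P /pullback comp_mpoly1 -mpolyC1 !dirderC0 comp_mpoly0.
have PX i : P 'X_i.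
  rewrite /P dirderXi /pullback comp_mpolyC comp_mpolyXU -tnth_nth tnth_mktuple.
  rewrite linear_sum mxE [RHS]raddf_sum /=.
  by under eq_bigr => j _ do rewrite linearZ /= dirderXi -mul_mpolyC -mpolyCM.
have PXm m : P 'X_[m].
  rewrite mpolyXE_id; apply: big_ind => [||i _]; [exact: P1 | exact: PM |].
  elim: (m i) => [|k IHk]; first by rewrite expr0; exact: P1.
  by rewrite exprS; apply: PM.
rewrite [q]mpolyE (linear_sum (pullback X)) (linear_sum (dirder v)).
rewrite (linear_sum (dirder (X *m v))) (linear_sum (pullback X)).
apply: eq_bigr => m _; rewrite (linearZ_LR (pullback X)) (linearZ_LR (dirder v)).
rewrite (linearZ_LR (dirder (X *m v))) (linearZ_LR (pullback X)) /=.
by congr (_ *: _); exact: PXm.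
Qed.

End Pullback.

(** * Two blocks *)

Section TwoBlocks.
Variables (K : numFieldType) (n d : nat).
Hypotheses (n_ge4 : (4 <= n)%N) (d_ge3 : (3 <= d)%N).
Implicit Types (f g h p q : {mpoly K[n]}) (v w x y : 'cV[K]_n) (s : 'S_n).
Variables (f h : {mpoly K[n]}) (a : K) (chi : linChar).
Hypotheses (f_form : f \is d.-homog) (f_nd : nondegenerate_form f).
Hypothesis f_inv : jacobian_invariant f.
Hypothesis h_infl : inflated_from_Hn d h.
Hypothesis h_chi : affords chi h.
Hypothesis fE : f = a *: sumx ^+ d + h.

Lemma dirder_onev_h : dirder (onev K n) h = 0.
Proof.
have [q _ ->] := h_infl; rewrite dirder_pullback.
have -> : projH K n *m onev K n = 0.
  rewrite projHE -/(vsum _) vsum_onev mulVf ?(n_neq0 K n_ge4) //.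
  by apply/colP => i; rewrite !mxE subrr.
by rewrite dirder0l /pullback comp_mpoly0.
Qed.

Lemma h_form : h \is d.-homog.
Proof.
rewrite (_ : h = f - a *: sumx ^+ d); last by rewrite fE addrC addKr.
by rewrite rpredB // rpredZ // sumx_homog.
Qed.

Lemma d_gt0 : (0 < d)%N. Proof. exact: leq_trans d_ge3. Qed.

Lemma dirder_sumx_expd v : dirder v (sumx ^+ d) = (d%:R * vsum v) *: sumx ^+ d.-1.
Proof. by case: d d_gt0 => // k _; rewrite dirder_sumx_exp. Qed.

Lemma dirder_two_blocks (b c : K) v :
  dirder v (b *: sumx ^+ d + c *: h) = (b * (d%:R * vsum v)) *: sumx ^+ d.-1 + c *: dirder v h.
Proof. by rewrite linearD !linearZ /= dirder_sumx_expd scalerA. Qed.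

Lemma fE_scale1 : f = a *: sumx ^+ d + 1 *: h. Proof. by rewrite scale1r. Qed.

Lemma dirder_onev_f : dirder (onev K n) f = (a * (d%:R * n%:R)) *: sumx ^+ d.-1.
Proof. by rewrite fE_scale1 dirder_two_blocks dirder_onev_h scaler0 addr0 vsum_onev. Qed.

Lemma sumx_coef_neq0 : a != 0.
Proof.
apply/eqP => a0; have := dirder_onev_f; rewrite a0 mul0r scale0r => /f_nd.
pose o : 'I_n := Ordinal (leq_trans (isT : (0 < 4)%N) n_ge4).
by move/colP/(_ o)/eqP; rewrite !mxE oner_eq0.
Qed.

(** D_1 f is a multiple of s^(d-1), so both sides are the same multiple of (sum u)(sum v) s^(d-2).
    This puts the projection onto H_n into the center. *)
Lemma dcenter_onev_onev : dcenter f (outer (onev K n) (onev K n)).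
Proof.
have D1 v : dirder (onev K n) (dirder v f) =
    (a * (d%:R * n%:R) * (d.-1%:R * vsum v)) *: sumx ^+ d.-2.
  rewrite dirderC dirder_onev_f linearZ /=.
  by case: d d_ge3 => [|[|k]] // _; rewrite dirder_sumx_exp scalerA.
move=> u v; rewrite !outer_onev_mul !dirderZl linearZ /= (dirderC u) !D1 !scalerA.
by congr (_ *: _); ring.
Qed.

Hypothesis dec : canonical_decomposition d f [:: Tn; Hn].

Lemma two_blocks_fiber g : jacobian_fiber d f g <->
  exists b c : K, [/\ b != 0, c != 0 & g = b *: sumx ^+ d + c *: h].
Proof.
split=> [[gd gf]|[b [c [b0 c0 gE]]]].
  have [Y YE Ysurj] := same_jacobian_matrix f_nd gf.
  have irr := two_blocks_irreducible n_ge4 d_ge3 f_form f_nd dcenter_onev_onev dec.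
  have [x [y Yxy]] := dcenter_shape n_ge4 d_ge3 f_form f_nd f_inv irr (dcenter_jacobian_matrix YE).
  move: Ysurj; rewrite Yxy => /(scalar_const_mx_surj n_ge4)[x0 xy0].
  (* Y acts by x on H_n and by x + n y on T. *)
  exists (a * (x + n%:R * y)), x; split=> //; first by rewrite mulf_neq0 ?sumx_coef_neq0.
  apply: (form_eq_dirder d_ge3) => // [|v].
    by rewrite rpredD // rpredZ ?sumx_homog ?h_form.
  rewrite YE Yxy mul_scalar_const_mx dirderDl !dirderZl dirder_onev_f dirder_two_blocks.
  rewrite {1}fE_scale1 dirder_two_blocks scale1r scalerDr !scalerA addrAC -scalerDl.
  by congr (_ *: _ + _); ring.
split; first by rewrite gE rpredD // rpredZ ?sumx_homog ?h_form.
have n0 := n_neq0 K n_ge4; have a0 := sumx_coef_neq0.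
(* Chosen so that c + yJ has eigenvalue c on H_n and b/a on T. *)
pose y := (b / a - c) / n%:R.
apply: (@same_jacobian_of_matrix K n f g (c%:M + const_mx y)) => [v|w].
  rewrite mul_scalar_const_mx dirderDl !dirderZl dirder_onev_f gE dirder_two_blocks.
  rewrite {1}fE_scale1 dirder_two_blocks scale1r scalerDr !scalerA addrAC -scalerDl.
  by congr (_ *: _ + _); rewrite /y; field; rewrite a0 n0.
(* The inverse of c + yJ applied to w. *)
exists (c^-1 *: w - (y * vsum w / (c * (b / a))) *: onev K n).
rewrite mul_scalar_const_mx vsumB !vsumZ vsum_onev.
rewrite scalerBr !scalerA divff // scale1r -addrA -scaleNr -scalerDl.
rewrite (_ : - _ + _ = 0) ?scale0r ?addr0 // /y; field.
by rewrite n0 b0 c0 a0.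
Qed.

Lemma vsum_decomposition v : exists c w, w \in Hn /\ v = c *: onev K n + w.
Proof.
exists (n%:R^-1 * vsum v), (projH K n *m v); split.
  by apply: projH_in; exact: n_neq0.
by rewrite projHE; apply/colP => i; rewrite !mxE mulr1 addrC subrK.
Qed.

(** The map is (c, u) |-> D_{c1+u} f. On T it yields multiples of the invariant s^(d-1); on H_n the
    summand s^d contributes nothing, so only the character of h appears. *)
Lemma two_blocks_iso : isoSn (jacMod f_inv) (sumMod trivMod (twistMod chi HMod)).
Proof.
apply: isoSn_sym; exists (fun u : K^o * 'cV[K]_n => dirder (u.1 *: onev K n + u.2) f); split=> /=.
- by move=> u _; apply/jacobianP; eexists.
- move=> c u v _ _; rewrite -dirderZl -dirderDl; congr dirder.
  by rewrite /= scalerDl scalerDr scalerA addrACA.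
- move=> [c u] [c' u'] /= [_ uH] [_ u'H] /(nondegenerate_inj f_nd) e.
  have cc : c = c'.
    move/(congr1 (@vsum K n)): (e); rewrite !linearD !linearZ /= vsum_onev.
    by rewrite !(vsum_Hn _) // !addr0 => /(mulIf (n_neq0 K n_ge4)).
  by rewrite cc in e *; move/addrI: e => ->.
- move=> w /jacobianP[v ->]; have [c [u [uH ->]]] := vsum_decomposition v.
  by exists (c, u).
- move=> s [c u] [_ uH] /=; rewrite !dirderDl !dirderZl msymD msymZ; congr (_ + _).
    by rewrite dirder_onev_f msymZ msym_sumx_exp.
  have us : vsum (permc s u) = 0 by rewrite vsum_permc vsum_Hn.
  rewrite msym_dirder fE_scale1 msymD !msymZ msym_sumx_exp h_chi.
  by rewrite !scale1r !linearD !linearZ /= !dirder_sumx_expd us mulr0 !scale0r !scaler0 !add0r.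
Qed.

Lemma dirder_onev_two_blocks_neq0 (b c : K) :
  b != 0 -> dirder (onev K n) (b *: sumx ^+ d + c *: h) != 0.
Proof.
move=> b0; rewrite dirder_two_blocks dirder_onev_h scaler0 addr0 vsum_onev.
rewrite scaler_eq0 negb_or !mulf_neq0 ?pnatr_eq0 -?lt0n ?d_gt0 ?(leq_trans _ n_ge4) //.
by apply: sumx_exp_neq0; apply: leq_trans n_ge4.
Qed.

Lemma h_neq0 : h != 0.
Proof.
pose o : 'I_n := Ordinal (leq_trans (isT : (0 < 4)%N) n_ge4).
pose o' : 'I_n := Ordinal (leq_trans (isT : (1 < 4)%N) n_ge4).
apply: contraNneq (@uvec_neq0 K n o o' isT) => h0; apply/eqP/f_nd.
by rewrite fE_scale1 dirder_two_blocks vsum_uvec h0 !mulr0 scale0r linear0 scaler0 addr0.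
Qed.

(** D_1 g is a nonzero multiple of the invariant s^(d-1), so a relatively invariant g is fixed by a
    transposition; the sign character would then give c h = - c h. *)
Lemma two_blocks_relative_invariant :
  (exists2 g, jacobian_fiber d f g & relative_invariant g) <-> chi = TrivChar.
Proof.
split=> [[g /two_blocks_fiber[b [c [b0 c0 gE]]] [_ g_inv]]|chi1]; last first.
  exists (1 *: sumx ^+ d + 1 *: h).
    by apply/two_blocks_fiber; exists 1, 1; rewrite oner_eq0.
  split=> [|s]; last first.
    by exists 1; rewrite msymD !msymZ msym_sumx_exp h_chi chi1 /= !scale1r.
  by apply: contraNneq (dirder_onev_two_blocks_neq0 1 (oner_neq0 K)) => ->; rewrite linear0.
case chiE: chi => //.
pose o : 'I_n := Ordinal (leq_trans (isT : (0 < 4)%N) n_ge4).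
pose o' : 'I_n := Ordinal (leq_trans (isT : (1 < 4)%N) n_ge4).
pose s := tperm o o'; have [lambda gs] := g_inv s.
have D1g : dirder (onev K n) g != 0 by rewrite gE dirder_onev_two_blocks_neq0.
have lambda1 : lambda = 1.
  have : dirder (onev K n) (msym s g) = dirder (onev K n) g.
    rewrite -{1}(permc_onev K s) -msym_dirder gE dirder_two_blocks dirder_onev_h scaler0 addr0.
    by rewrite msymZ msym_sumx_exp.
  rewrite gs linearZ /= => /eqP; rewrite -subr_eq0 -{2}[dirder _ g]scale1r -scalerBl.
  by rewrite scaler_eq0 (negPf D1g) orbF subr_eq0 => /eqP.
move/eqP: gs; rewrite lambda1 scale1r gE msymD !msymZ msym_sumx_exp h_chi chiE /=.
rewrite odd_tperm /= expr1 scaleN1r (inj_eq (addrI _)) -subr_eq0 scalerN -opprD.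
rewrite oppr_eq0 -mulr2n -scaler_nat scalerA scaler_eq0 mulf_eq0 (negPf c0) (negPf h_neq0).
by rewrite pnatr_eq0.
Qed.

End TwoBlocks.

(** * n blocks *)

Section PowerSums.
Variables (K : numFieldType) (n d : nat) (gamma : K).
Hypotheses (d_ge3 : (3 <= d)%N) (gamma_ok : 1 + n%:R * gamma != 0).
Implicit Types (f g p : {mpoly K[n]}) (v w : 'cV[K]_n) (s : 'S_n) (i j : 'I_n).

Definition lform i : {mpoly K[n]} := 'X_i + gamma *: sumx.
Definition lcoord i v : K := v i 0 + gamma * vsum v.
(** The correction cancels gamma = l_i(e_j) - delta_ij, since l_i takes the value 1 + n gamma on the
    all-ones vector. *)
Definition dualv j : 'cV[K]_n := evec K j - (gamma / (1 + n%:R * gamma)) *: onev K n.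
Definition powsum (c : 'I_n -> K) : {mpoly K[n]} := \sum_i c i *: lform i ^+ d.

Lemma lcoord_dualv i j : lcoord i (dualv j) = (i == j)%:R.
Proof.
rewrite /lcoord vsumB vsumZ vsum_onev vsum_evec mxE evecE !mxE mulr1.
by field.
Qed.

Lemma lcoordD i v w : lcoord i (v + w) = lcoord i v + lcoord i w.
Proof. by rewrite /lcoord vsumD mxE; ring. Qed.

Lemma lcoordZ i a v : lcoord i (a *: v) = a * lcoord i v.
Proof. by rewrite /lcoord vsumZ mxE; ring. Qed.

Lemma lcoord_surj (t : 'I_n -> K) : exists v, forall i, lcoord i v = t i.
Proof.
exists (\sum_j t j *: dualv j) => i.
have lcoord0 : lcoord i 0 = 0 by rewrite -(scale0r 0) lcoordZ mul0r.
rewrite (big_morph (lcoord i) (lcoordD i) lcoord0) (bigD1 i) //= big1 => [|j ji].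
  by rewrite lcoordZ lcoord_dualv eqxx mulr1 addr0.
by rewrite lcoordZ lcoord_dualv eq_sym (negPf ji) mulr0.
Qed.

Lemma dirder_lform i v : dirder v (lform i) = (lcoord i v)%:MP.
Proof. by rewrite linearD linearZ /= dirderXi dirder_sumx mpolyCD mpolyCM mul_mpolyC. Qed.

Lemma formval_lform i v : formval (lform i) v = lcoord i v.
Proof.
rewrite /formval mevalD mevalZ mevalXU /sumx raddf_sum; congr (_ + _ * _).
by apply: eq_bigr => j _; rewrite /= mevalXU.
Qed.

Lemma dirder_sum_lform (c : 'I_n -> K) k v :
  dirder v (\sum_i c i *: lform i ^+ k.+1) =
    \sum_i (c i * k.+1%:R * lcoord i v) *: lform i ^+ k.
Proof.
rewrite (linear_sum (dirder v)); apply: eq_bigr => i _.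
rewrite (linearZ_LR (dirder v)) /= dirder_exp dirder_lform [_ * _%:MP]mulrC mul_mpolyC.
by rewrite !scalerA.
Qed.

Lemma formval_sum_lform_dualv (c : 'I_n -> K) k j :
  formval (\sum_i c i *: lform i ^+ k.+1) (dualv j) = c j.
Proof.
rewrite /formval raddf_sum (bigD1 j) //= big1 => [|i ij].
  by rewrite mevalZ rmorphXn /= -/(formval _ _) formval_lform lcoord_dualv eqxx expr1n mulr1 addr0.
rewrite mevalZ rmorphXn /= -/(formval _ _) formval_lform lcoord_dualv (negPf ij).
by rewrite expr0n mulr0.
Qed.

Lemma powsum_homog c : powsum c \is d.-homog.
Proof.
have l1 i : lform i \is 1.-homog.
  rewrite rpredD ?rpredZ ?dhomogX //; first by apply/eqP/mdeg1.
  by rewrite -[sumx]expr1 sumx_homog.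
rewrite rpred_sum // => i _; rewrite rpredZ //.
by have := dhomogMn d (l1 i); rewrite mul1n.
Qed.

(** The values l_i(v) can be prescribed freely, so the ratios b_i / c_i are absorbed into the
    direction of differentiation. *)
Lemma powsum_same_jacobian b c : (forall i, b i != 0) -> (forall i, c i != 0) ->
  same_jacobian (powsum b) (powsum c).
Proof.
have sub b' c' : (forall i, c' i != 0) ->
    forall p, jacobian (powsum b') p -> jacobian (powsum c') p.
  move=> c0 p /jacobianP[v ->]; have [w wE] := lcoord_surj (fun i => b' i / c' i * lcoord i v).
  apply/jacobianP; exists w; rewrite /powsum; case: d d_ge3 => // k _.
  rewrite !dirder_sum_lform; apply: eq_bigr => i _; congr (_ *: _).
  by rewrite wE; field.
by move=> b0 c0 p; split; apply: sub.
Qed.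

(** * Jacobian and fiber of a sum of powers *)

Section Fixed.
Variables (f : {mpoly K[n]}) (c : 'I_n -> K).
Hypotheses (f_nd : nondegenerate_form f) (f_inv : jacobian_invariant f).
Hypotheses (c_neq0 : forall i, c i != 0) (fE : f = powsum c).

(** Evaluation at the dual basis reads off the coefficients of the l_i^(d-1), and permutations
    permute that basis. *)
Lemma powsum_iso : isoSn (jacMod f_inv) permMod.
Proof.
exists (fun p => \col_i formval p (dualv i)); split=> //=.
- by move=> a u v _ _; apply/colP => i; rewrite !mxE /formval mevalD mevalZ.
- move=> p q /jacobianP[v ->] /jacobianP[w ->] /colP e.
  (* Writing d as k + 2 makes the exponent d - 1 positive, so evaluation at [dualv i] isolates one
     coefficient. *)
  move: e; rewrite fE /powsum; case: d d_ge3 => [|[|k]] // _.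
  rewrite !dirder_sum_lform => e; apply: eq_bigr => i _; congr (_ *: _).
  by have := e i; rewrite !mxE !formval_sum_lform_dualv.
- move=> w _; have [v vE] := lcoord_surj (fun i => w i 0 / (c i * d%:R)).
  exists (dirder v f); first by apply/jacobianP; exists v.
  apply/colP => i; rewrite mxE fE /powsum; move: vE; case: d d_ge3 => [|[|k]] // _ vE.
  rewrite dirder_sum_lform formval_sum_lform_dualv vE mulrC divfK //.
  by rewrite mulf_neq0 ?pnatr_eq0.
- move=> s p _; apply/colP => i; rewrite !mxE formval_msym; congr formval.
  by rewrite linearB linearZ /= permc_evec permc_onev.
Qed.

Lemma powsum_fiber g : jacobian_fiber d f g <->
  exists2 b : 'I_n -> K, forall i, b i != 0 & g = powsum b.
Proof.
split=> [[gd gf]|[b b0 ->]]; last first.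
  by split; [exact: powsum_homog | rewrite fE; exact: powsum_same_jacobian].
have [Y YE Ysurj] := same_jacobian_matrix f_nd gf.
have fY := dcenter_jacobian_matrix YE.
(* Y is diagonal in the dual basis: the center condition for v and [dualv j] is evaluated at
   [dualv j], where the exponent d - 2 is still positive. *)
have Yl j v : lcoord j (Y *m v) = lcoord j (Y *m dualv j) * lcoord j v.
  have := congr1 (fun p => formval p (dualv j)) (fY v (dualv j)).
  rewrite fE /powsum; case: d d_ge3 => [|[|[|k]]] // _.
  rewrite !dirder_sum_lform !formval_sum_lform_dualv lcoord_dualv eqxx mulr1.
  set N := c j * _ => e; have N0 : N * k.+2%:R != 0 by rewrite !mulf_neq0 ?pnatr_eq0.
  by apply: (mulfI N0); rewrite e; ring.
(* The factors multiplying c_i are the eigenvalues of Y, nonzero because Y is surjective. *)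
exists (fun i => c i * lcoord i (Y *m dualv i)) => [i|].
  rewrite mulf_neq0 //; have [v vE] := Ysurj (dualv i).
  apply/eqP => y0; have := Yl i v.
  by rewrite vE lcoord_dualv eqxx y0 mul0r => /eqP; rewrite oner_eq0.
apply: (form_eq_dirder d_ge3) => // [|v]; first exact: powsum_homog.
rewrite YE fE /powsum; case: d d_ge3 => // k _; rewrite !dirder_sum_lform.
by apply: eq_bigr => i _; rewrite Yl; congr (_ *: _); ring.
Qed.

End Fixed.

Lemma msym_lform s i : msym s (lform i) = lform (s i).
Proof.
rewrite msymD msymZ msym_sumx msymX; congr ('X_[_] + _).
by apply/mnmP => j; rewrite mnmE !mnm1E (can2_eq (permK s) (permKV s)).
Qed.

Lemma msym_powsum1 s : msym s (\sum_i lform i ^+ d) = \sum_i lform i ^+ d.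
Proof.
rewrite linear_sum [RHS](reindex_inj (@perm_inj _ s)) /=.
by apply: eq_bigr => i _; rewrite rmorphXn /= msym_lform.
Qed.

End PowerSums.

Theorem corollary4p7 (R : realType) (n d : nat) (hn : (5 <= n)%N) (hd : (3 <= d)%N)
    (f : {mpoly R[i][n]}) (f_form : f \is d.-homog) (f_nondeg : nondegenerate_form f)
    (f_inv : jacobian_invariant f) :
  [/\ (* (i) *)
      forall chi : linChar,
        canonical_decomposition d f [:: fullv] ->
        affords chi f ->
        isoSn (jacMod f_inv) (twistMod chi permMod) /\
        (forall g : {mpoly R[i][n]}, jacobian_fiber d f g <->
           exists2 c : R[i], c != 0 & g = c *: f),
      (* (ii) *)
      forall (chi : linChar) (a : R[i]) (h : {mpoly R[i][n]}),
        canonical_decomposition d f [:: Tn; Hn] ->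
        inflated_from_Hn d h ->
        affords chi h ->
        f = a *: sumx ^+ d + h ->
        [/\ isoSn (jacMod f_inv) (sumMod trivMod (twistMod chi HMod)),
            (forall g : {mpoly R[i][n]}, jacobian_fiber d f g <->
               exists b c : R[i],
                 [/\ b != 0, c != 0 & g = b *: sumx ^+ d + c *: h])
          & (exists2 g : {mpoly R[i][n]},
               jacobian_fiber d f g & relative_invariant g) <-> chi = TrivChar]
    & (* (iii) *)
      forall (c : 'I_n -> R[i]) (gamma : R[i]),
        (exists2 Vs, canonical_decomposition d f Vs & size Vs = n) ->
        (forall i, c i != 0) ->
        1 + n%:R * gamma != 0 ->
        let l := fun i : 'I_n => 'X_i + gamma *: sumx : {mpoly R[i][n]} in
        f = \sum_i c i *: l i ^+ d ->
        [/\ isoSn (jacMod f_inv) permMod,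
            (forall g : {mpoly R[i][n]}, jacobian_fiber d f g <->
               exists2 b : 'I_n -> R[i],
                 forall i, b i != 0 & g = \sum_i b i *: l i ^+ d)
          & forall s : 'S_n, msym s (\sum_i l i ^+ d) = \sum_i l i ^+ d]].
Proof.
have n_ge4 : (4 <= n)%N by exact: ltnW.
split.
- move=> chi dec f_chi; split; first exact: jacobian_permMod_iso.
  by move=> g; exact: (@single_block_fiber R[i] n d).
- move=> chi a h dec h_infl h_chi fE; split.
  + exact: (@two_blocks_iso R[i] n d n_ge4 hd f h a).
  + move=> g; exact: (@two_blocks_fiber R[i] n d n_ge4 hd f h a).
  + exact: (@two_blocks_relative_invariant R[i] n d n_ge4 hd f h a).
- move=> c gamma _ c0 gamma0 l fE; split.
  + exact: (@powsum_iso R[i] n d gamma hd gamma0 f c).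
  + move=> g; exact: (@powsum_fiber R[i] n d gamma hd gamma0 f c).
  + exact: (@msym_powsum1 R[i] n d gamma).
Qed.
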